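(* Let $t \geq 2$ be an even integer and let $G$ be a $3$-connected $2t$-regular graph. Let $\mathcal{O}$ be a set of pairwise edge-disjoint cycles of $G$, each of length at least $3$. Then there exists a $t$-factor $F$ of $G$ such that for every $O \in \mathcal{O}$ both $E(O) \cap E(F) \neq \emptyset$ and $E(O) \cap (E(G) \setminus E(F)) \neq \emptyset$.
   Context: All graphs are finite and loopless but may have parallel edges. A cycle is a connected $2$-regular subgraph; its length is its number of edges. A $t$-factor of $G$ is a spanning $t$-regular subgraph. $3$-connected means $G$ has more than $3$ vertices and remains connected after deleting any at most $2$ vertices. *)

(* Defs.v *)
From mathcomp Require Import all_boot.
Set Implicit Arguments. Unset Strict Implicit. Unset Printing Implicit Defensive.

(* A multigraph: vertex type V, edge type E, each edge e has two endpoints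
   (ends e).1 and (ends e).2.  Parallel edges are allowed (distinct edges
   with the same ends); looplessness is the hypothesis [loopless ends]. *)

Definition loopless (V E : finType) (ends : E -> V * V) : Prop :=
  forall e, (ends e).1 != (ends e).2.

Definition incident (V E : finType) (ends : E -> V * V) (e : E) (v : V) : bool :=
  (v == (ends e).1) || (v == (ends e).2).

(* degree of v in the spanning subgraph with edge set S (loopless graphs) *)
Definition deg (V E : finType) (ends : E -> V * V) (S : {set E}) (v : V) : nat :=
  #|[set e in S | incident ends e v]|.

Definition adj_in (V E : finType) (ends : E -> V * V) (S : {set E}) : rel V :=
  fun x y => [exists e in S, ((ends e).1 == x) && ((ends e).2 == y)
                          || ((ends e).1 == y) && ((ends e).2 == x)].

(* A cycle (connected 2-regular subgraph), represented by its edge set C;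
   its vertex set is the set of vertices incident with C. *)
Definition is_cycle (V E : finType) (ends : E -> V * V) (C : {set E}) : Prop :=
  C != set0 /\
  (forall v, deg ends C v = 0 \/ deg ends C v = 2) /\
  (forall x y, 0 < deg ends C x -> 0 < deg ends C y -> connect (adj_in ends C) x y).

Definition adj_avoid (V E : finType) (ends : E -> V * V) (S : {set V}) : rel V :=
  fun x y => (x \notin S) && (y \notin S) && adj_in ends setT x y.

Definition three_connected (V E : finType) (ends : E -> V * V) : Prop :=
  3 < #|V| /\
  forall S : {set V}, #|S| <= 2 ->
    forall x y, x \notin S -> y \notin S -> connect (adj_avoid ends S) x y.

Definition regular (V E : finType) (ends : E -> V * V) (S : {set E}) (k : nat) : Prop :=
  forall v, deg ends S v = k.

Definition t_factor (V E : finType) (ends : E -> V * V) (t : nat) (F : {set E}) : Prop :=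
  regular ends F t.

(* Main.v *)
(** The edges of [F] should alternate along closed trails that turn, for each
    cycle [C] of [O], at some vertex [vO C] from one edge of [C] to the next; then
    [F] splits every [C].  Detaching these turns (the vertex [inr C] below carries
    the two edges of [C] at [vO C]) leaves an even graph, which has a balanced
    2-colouring as soon as all its components have an even number of edges.
    Since [t] is even, this parity condition holds if the pairs [(vO C, C)] can be
    chosen inside an even subgraph of the incidence graph on [V + O], whose edges
    are the incidences between vertices and cycles together with the edges lying
    on no cycle.  So it suffices to find an even subgraph meeting every [C].

    The incidence graph is bridgeless because [G] is 2-connected and has degree at
    least 4, and each [C] has degree [#|C| >= 3] in it.  By a theorem of Fleischner
    (a form of Petersen's theorem), a bridgeless graph has an even subgraph meeting
    every vertex of degree at least 3.  As in Frink's proof of Petersen's theorem,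
    one shows more, namely that it may be required to contain a given edge [a], and
    uses induction on the number of edges: [a] is spliced with a second edge at one
    of its ends, after contracting an edge when that end has degree 3. *)
Require Import Defs.
From mathcomp Require Import all_boot.
From mathcomp Require Import zify.
Set Implicit Arguments. Unset Strict Implicit. Unset Printing Implicit Defensive.

(** * Edge sums, cuts and splices *)

(** Degrees and cut sizes are both sums of a weight of the pair of ends, so the same rules tell how
    splicing changes either. *)
Definition wsum (V E : finType) (ends : E -> V * V) (S : {set E})
  (w : V * V -> nat) : nat := \sum_(e in S) w (ends e).

Definition crossing (V : finType) (X : {set V}) (p : V * V) : nat :=
  (p.1 \in X) (+) (p.2 \in X).

(** A loop counts twice, unlike in [deg]: splices and contractions create loops, and the parity of
    degrees must survive them. *)
Definition endcount (V : finType) (v : V) (p : V * V) : nat :=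
  (p.1 == v) + (p.2 == v).

(** A bridge is an edge that forms a cut on its own; this form suits disconnected graphs as well. *)
Definition bridgeless (V E : finType) (ends : E -> V * V) (S : {set E}) : bool :=
  [forall X : {set V}, wsum ends S (crossing X) != 1].

Definition upd (V E : finType) (ends : E -> V * V) (a : E) (p : V * V) : E -> V * V :=
  fun e => if e == a then p else ends e.

(** Meaningful only if [x] is an end of [e]; for a loop at [x] the value is [x]. *)
Definition otherend (V E : finType) (ends : E -> V * V) (e : E) (x : V) : V :=
  if (ends e).1 == x then (ends e).2 else (ends e).1.

(* Replaces the path [a], [c] through [x] by a single edge, which keeps the label
   [a]; the label [c] has to be dropped from the set of edges in use. *)
Definition splice (V E : finType) (ends : E -> V * V) (x : V) (a c : E) : E -> V * V :=
  upd ends a (otherend ends a x, otherend ends c x).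

Lemma wsumD1 (V E : finType) (ends : E -> V * V) (S : {set E}) w a :
  a \in S -> wsum ends S w = w (ends a) + wsum ends (S :\ a) w.
Proof. by move=> aS; rewrite /wsum (big_setD1 a). Qed.

Lemma wsum_upd (V E : finType) (ends : E -> V * V) (S : {set E}) w a p :
  a \in S -> wsum (upd ends a p) S w = w p + wsum ends (S :\ a) w.
Proof.
move=> aS; rewrite (wsumD1 _ _ aS) {1}/upd eqxx; congr (_ + _).
by apply: eq_bigr => e; rewrite !inE /upd => /andP[/negPf-> _].
Qed.

Lemma wsum_upd_notin (V E : finType) (ends : E -> V * V) (S : {set E}) w a p :
  a \notin S -> wsum (upd ends a p) S w = wsum ends S w.
Proof.
move=> aS; apply: eq_bigr => e eS; rewrite /upd; case: eqP => // ea.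
by rewrite -ea eS in aS.
Qed.

Lemma eq_wsum (V E : finType) (ends : E -> V * V) (S : {set E}) w w' :
  (forall e, e \in S -> w (ends e) = w' (ends e)) -> wsum ends S w = wsum ends S w'.
Proof. by move=> h; apply: eq_bigr => e /h. Qed.

Lemma crossing_otherend (V E : finType) (ends : E -> V * V) e x X :
  incident ends e x ->
  crossing X (ends e) = (x \in X) (+) (otherend ends e x \in X) :> nat.
Proof.
rewrite /incident /crossing /otherend eq_sym; case: eqP => [-> //|_ /= /eqP->].
by rewrite addbC.
Qed.

Lemma endcount_otherend (V E : finType) (ends : E -> V * V) e x v :
  incident ends e x ->
  endcount v (ends e) = (x == v) + (otherend ends e x == v).
Proof.
rewrite /incident /endcount /otherend eq_sym; case: eqP => [-> //|_ /= /eqP->].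
by rewrite addnC.
Qed.

Lemma crossingC (V E : finType) (ends : E -> V * V) (S : {set E}) X :
  wsum ends S (crossing (~: X)) = wsum ends S (crossing X).
Proof. by apply: eq_wsum => e _; rewrite /crossing !inE; do 2!case: (_ \in X). Qed.

Lemma sum_pred1 (V : finType) (X : {set V}) u :
  \sum_(v in X) ((u == v) : nat) = (u \in X).
Proof.
case uX: (u \in X).
  rewrite (big_setD1 u) //= eqxx big1 // => v; rewrite !inE eq_sym => /andP[/negPf-> //].
by rewrite big1 // => v vX; case: eqP => // uv; rewrite uv vX in uX.
Qed.

Lemma sum_endcount (V E : finType) (ends : E -> V * V) (S : {set E}) (X : {set V}) :
  \sum_(v in X) wsum ends S (endcount v) =
  wsum ends S (fun p => (p.1 \in X) + (p.2 \in X)).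
Proof.
rewrite /wsum exchange_big /=; apply: eq_bigr => e _.
by rewrite /endcount big_split /= !sum_pred1.
Qed.

Lemma odd_sum_even (I : finType) (P : pred I) (F : I -> nat) :
  (forall i, P i -> ~~ odd (F i)) -> ~~ odd (\sum_(i | P i) F i).
Proof.
by move=> h; elim/big_ind: _ => // m n; rewrite oddD => /negPf-> /negPf->.
Qed.

(** Summing the degrees over [X] counts an edge inside [X] twice and a crossing edge once. *)
Lemma even_crossing (V E : finType) (ends : E -> V * V) (S : {set E}) (X : {set V}) :
  (forall v, ~~ odd (wsum ends S (endcount v))) ->
  ~~ odd (wsum ends S (crossing X)).
Proof.
move=> ev.
have := odd_sum_even (P := mem X) (fun v _ => ev v).
rewrite sum_endcount.
suff -> : odd (wsum ends S (fun p => (p.1 \in X) + (p.2 \in X))) =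
          odd (wsum ends S (crossing X)) by [].
rewrite /wsum; apply: (big_ind2 (fun a b => odd a = odd b)) => //.
  by move=> a b c d ab cd; rewrite !oddD ab cd.
by move=> e _; rewrite /crossing; do 2!case: (_ \in X).
Qed.

Lemma bridgelessP (V E : finType) (ends : E -> V * V) (S : {set E}) :
  reflect (forall X, wsum ends S (crossing X) <> 1) (bridgeless ends S).
Proof.
apply: (iffP forallP) => h X; first by apply/eqP; apply: h.
by apply/eqP; apply: h.
Qed.

(** * Even subgraphs of bridgeless graphs *)

(** Splicing changes the size of a cut only if both far ends lie opposite [x], and then lowers it by
    2. So a new bridge comes from such a cut, crossed by one edge besides [a] and [c]. *)
Lemma splice_bad (V E : finType) (ends : E -> V * V) (S : {set E}) x a c :
  bridgeless ends S -> a \in S -> c \in S -> a != c ->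
  incident ends a x -> incident ends c x ->
  ~~ bridgeless (splice ends x a c) (S :\ c) ->
  exists X : {set V}, [/\ x \notin X, otherend ends a x \in X,
     otherend ends c x \in X & wsum ends (S :\ c :\ a) (crossing X) = 1].
Proof.
move=> /bridgelessP bl aS cS ac ia ic /forallPn[X0 /negPn/eqP h0].
(* A set and its complement have the same cut, so [x] may be assumed outside. *)
have [X xX hX] : exists2 X : {set V}, x \notin X &
    wsum (splice ends x a c) (S :\ c) (crossing X) = 1.
  case xX: (x \in X0); last by exists X0; rewrite ?xX.
  by exists (~: X0); rewrite ?inE ?xX // crossingC.
exists X; have := bl X.
have aSc : a \in S :\ c by rewrite !inE ac.
move: hX; rewrite wsum_upd // (wsumD1 _ _ cS) (wsumD1 _ _ aSc).
rewrite !(crossing_otherend _ ia, crossing_otherend _ ic) (negPf xX).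
have -> p : crossing X p = (p.1 \in X) (+) (p.2 \in X) by [].
move: (wsum _ _ _) => r /=.
by case: (_ \in X); case: (_ \in X) => /= h1 h2; split=> //; clear -h1 h2; lia.
Qed.

(** The indices 1, 2, 3, 0 name the parts [X :&: Y], [X :\: Y], [Y :\: X] and the outside of both;
    each number counts the edges between the two parts in its name. *)
Lemma quadrants (V E : finType) (ends : E -> V * V) (S : {set E}) (X Y : {set V}) :
  exists n12 n13 n10 n23 n20 n30,
  [/\ wsum ends S (crossing X) = n13 + n10 + n23 + n20,
      wsum ends S (crossing Y) = n12 + n10 + n23 + n30,
      wsum ends S (crossing (X :&: Y)) = n12 + n13 + n10 &
      [/\ wsum ends S (crossing (X :\: Y)) = n12 + n23 + n20,
          wsum ends S (crossing (Y :\: X)) = n13 + n23 + n30 &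
          wsum ends S (crossing (X :|: Y)) = n10 + n20 + n30]].
Proof.
pose q (i j : bool * bool) (p : V * V) : nat :=
  let f v := (v \in X, v \in Y) in
  ((f p.1 == i) && (f p.2 == j)) || ((f p.1 == j) && (f p.2 == i)).
pose N i j := wsum ends S (q i j).
pose tt_ := (true, true); pose tf := (true, false).
pose ft := (false, true); pose ff := (false, false).
exists (N tt_ tf), (N tt_ ft), (N tt_ ff), (N tf ft), (N tf ff), (N ft ff).
rewrite /N /wsum -!big_split; split; last split.
all: apply: eq_bigr => e _; rewrite /q /crossing ?inE /=.
all: by case: ((ends e).1 \in X); case: ((ends e).1 \in Y);
        case: ((ends e).2 \in X); case: ((ends e).2 \in Y).
Qed.

(* Uncrossing: the bad sets [X] and [Y] of the two splices split the vertices into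
   four parts, each containing one of the far ends of [a], [c], [d] or [x], and
   counting the edges between the parts shows that [X :|: Y] works. *)
Lemma splice_bad2 (V E : finType) (ends : E -> V * V) (S : {set E}) x a c d :
  bridgeless ends S -> a \in S -> c \in S -> d \in S ->
  a != c -> a != d -> c != d ->
  incident ends a x -> incident ends c x -> incident ends d x ->
  ~~ bridgeless (splice ends x a c) (S :\ c) ->
  ~~ bridgeless (splice ends x a d) (S :\ d) ->
  exists Y : {set V}, [/\ x \notin Y, otherend ends a x \in Y,
     otherend ends c x \in Y, otherend ends d x \in Y &
     wsum ends (S :\ c :\ a :\ d) (crossing Y) = 0].
Proof.
move=> bl aS cS dS ac ad cd ia ic id.
case/(splice_bad bl aS cS ac ia ic) => X [xX AX CX].
rewrite (@wsumD1 _ _ _ _ _ d) ?inE 1?eq_sym ?ad 1?eq_sym ?cd //.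
move=> hX.
case/(splice_bad bl aS dS ad ia id) => Y [xY AY DY].
have -> : S :\ d :\ a = c |: (S :\ c :\ a :\ d).
  by apply/setP => e; rewrite !inE; case: (eqVneq e c) => [->|_] /=;
     rewrite ?[c == a]eq_sym ?ac ?cd ?cS //= andbCA.
rewrite (@wsumD1 _ _ _ _ _ c) ?inE ?eqxx //.
have -> : (c |: (S :\ c :\ a :\ d)) :\ c = S :\ c :\ a :\ d.
  by apply/setP => e; rewrite !inE; case: (eqVneq e c) => [->|_] //=; rewrite !andbF.
move=> hY.
have full Q : wsum ends S (crossing Q) = crossing Q (ends a) + crossing Q (ends c)
    + crossing Q (ends d) + wsum ends (S :\ c :\ a :\ d) (crossing Q).
  rewrite (wsumD1 _ _ cS) (@wsumD1 _ _ _ _ _ a) ?inE ?ac //.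
  rewrite (@wsumD1 _ _ _ (S :\ c :\ a) _ d).
    by rewrite !addnA [crossing Q (ends c) + _]addnC.
  by rewrite !inE dS andbT eq_sym ad eq_sym.
move: hX hY; rewrite !(crossing_otherend _ id, crossing_otherend _ ic).
rewrite (negPf xX) (negPf xY) /=.
(* If [X] also contains the far end of [d], then [d] is the one further edge leaving [X], and [X]
   itself works; likewise [Y] with [c]. *)
case DX: (otherend ends d x \in X).
  by move=> [hX] _; exists X; split; rewrite ?DX.
case CY: (otherend ends c x \in Y).
  by move=> _ [hY]; exists Y; split; rewrite ?CY.
rewrite !add0n => hX hY.
exists (X :|: Y); rewrite !inE (negPf xX) (negPf xY) AX CX DY orbT; split=> //.
have [n12 [n13 [n10 [n23 [n20 [n30 [e1 e2 e3 [e4 e5 e6]]]]]]]] :=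
  quadrants ends (S :\ c :\ a :\ d) X Y.
have/bridgelessP bl' := bl.
(* Exactly one of [a], [c], [d] leaves each of these three parts, so another edge must leave it
   too. *)
have := bl' (X :&: Y); have := bl' (X :\: Y); have := bl' (Y :\: X).
rewrite !full !(crossing_otherend _ id, crossing_otherend _ ic, crossing_otherend _ ia).
rewrite !inE (negPf xX) (negPf xY) AX AY CX DY CY DX /=.
by move: hX hY; rewrite e1 e2 e3 e4 e5 e6; clear; lia.
Qed.

Lemma setD1C (E : finType) (S : {set E}) a b : S :\ a :\ b = S :\ b :\ a.
Proof. by apply/setP => e; rewrite !inE andbCA. Qed.

(** If all three splices fail, there is a set [Y] left only by [a], [c], [d] and a set [Z] left only
    by [a], [c], [e]. Then [d] is the only edge leaving [Y :\: Z], hence a bridge. *)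
Lemma splice_one_of_three (V E : finType) (ends : E -> V * V) (S : {set E}) x a c d e :
  bridgeless ends S -> uniq [:: a; c; d; e] ->
  (forall g, g \in [:: a; c; d; e] -> g \in S /\ incident ends g x) ->
  exists2 g, g \in [:: c; d; e] & bridgeless (splice ends x a g) (S :\ g).
Proof.
move=> bl uq h.
have [aS ia] : a \in S /\ incident ends a x by apply: h; rewrite !inE eqxx.
have [cS ic] : c \in S /\ incident ends c x by apply: h; rewrite !inE eqxx ?orbT.
have [dS id] : d \in S /\ incident ends d x by apply: h; rewrite !inE eqxx ?orbT.
have [eS ie] : e \in S /\ incident ends e x by apply: h; rewrite !inE eqxx ?orbT.
move: uq; rewrite /= !inE !negb_or !andbT -!andbA => /and5P[ac ad ae cd /andP[ce de]].
case bc: (bridgeless (splice ends x a c) (S :\ c)).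
  by exists c; rewrite ?inE ?eqxx.
case bd: (bridgeless (splice ends x a d) (S :\ d)).
  by exists d; rewrite ?inE ?eqxx ?orbT.
case be: (bridgeless (splice ends x a e) (S :\ e)).
  by exists e; rewrite ?inE ?eqxx ?orbT.
case: (splice_bad2 bl aS cS dS ac ad cd ia ic id (negbT bc) (negbT bd)).
move=> Y [xY AY CY DY].
rewrite (@wsumD1 _ _ _ _ _ e); last by rewrite !inE eS ![e == _]eq_sym ae ce de.
case: (splice_bad2 bl aS cS eS ac ae ce ia ic ie (negbT bc) (negbT be)).
move=> Z [xZ AZ CZ EZ].
rewrite (@wsumD1 _ _ _ _ _ d); last by rewrite !inE dS de [d == a]eq_sym ad [d == c]eq_sym cd.
rewrite [_ :\ e :\ d]setD1C.
have [n12 [n13 [n10 [n23 [n20 [n30 [e1 e2 _ [e4 _ _]]]]]]]] :=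
  quadrants ends (S :\ c :\ a :\ d :\ e) Y Z.
move/bridgelessP: bl => /(_ (Y :\: Z)).
rewrite (wsumD1 _ _ cS) (@wsumD1 _ _ _ _ _ a) ?inE ?ac //.
rewrite (@wsumD1 _ _ _ (S :\ c :\ a) _ d) ?inE ?dS ?[d == a]eq_sym ?ad ?[d == c]eq_sym ?cd //.
rewrite (@wsumD1 _ _ _ (S :\ c :\ a :\ d) _ e); last first.
  by rewrite !inE eS ![e == _]eq_sym ae ce de.
rewrite !(crossing_otherend _ id, crossing_otherend _ ic, crossing_otherend _ ia, crossing_otherend _ ie).
rewrite !inE (negPf xY) (negPf xZ) AY CY DY AZ CZ EZ /=.
by rewrite e1 e2 e4; case: (_ \in Y); case: (_ \in Z); clear; lia.
Qed.

(** Here [b] is excluded as a partner of [a]. If both other splices fail, uncrossing gives a set [Y]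
    left only by [a], [c], [d], all going to [x]; then [b] is the only edge leaving [x |: Y]. *)
Lemma splice_degree_four (V E : finType) (ends : E -> V * V) (S : {set E}) x a b c d :
  bridgeless ends S -> uniq [:: a; b; c; d] ->
  (forall g, (g \in S) && incident ends g x = (g \in [:: a; b; c; d])) ->
  otherend ends b x != x ->
  exists2 g, g \in [:: c; d] & bridgeless (splice ends x a g) (S :\ g).
Proof.
move=> bl uq h Bx.
have h' g : g \in [:: a; b; c; d] -> g \in S /\ incident ends g x.
  by rewrite -h => /andP.
have [aS ia] : a \in S /\ incident ends a x by apply: h'; rewrite !inE eqxx.
have [bS ib] : b \in S /\ incident ends b x by apply: h'; rewrite !inE eqxx ?orbT.
have [cS ic] : c \in S /\ incident ends c x by apply: h'; rewrite !inE eqxx ?orbT.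
have [dS id] : d \in S /\ incident ends d x by apply: h'; rewrite !inE eqxx ?orbT.
move: uq; rewrite /= !inE !negb_or !andbT -!andbA => /and5P[ab ac ad bc /andP[bd cd]].
case hc: (bridgeless (splice ends x a c) (S :\ c)).
  by exists c; rewrite ?inE ?eqxx.
case hd: (bridgeless (splice ends x a d) (S :\ d)).
  by exists d; rewrite ?inE ?eqxx ?orbT.
case: (splice_bad2 bl aS cS dS ac ad cd ia ic id (negbT hc) (negbT hd)).
move=> Y [xY AY CY DY].
have bS' : b \in S :\ c :\ a :\ d by rewrite !inE bS bd bc [b == a]eq_sym ab.
rewrite (wsumD1 _ _ bS') (crossing_otherend _ ib) (negPf xY).
set T := _ :\ b => hY.
have hT : wsum ends T (crossing (x |: Y)) = wsum ends T (crossing Y).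
  apply: eq_wsum => g; rewrite !inE => /and5P[gb gd ga gc gS].
  have : ~~ incident ends g x.
    by apply/negP => ig; have := h g; rewrite gS ig !inE (negPf ga) (negPf gb) (negPf gc) (negPf gd).
  rewrite /incident negb_or => /andP[g1 g2].
  by rewrite /crossing !inE ![_ == x]eq_sym (negPf g1) (negPf g2).
move/bridgelessP: bl => /(_ (x |: Y)).
rewrite (wsumD1 _ _ cS) (@wsumD1 _ _ _ _ _ a) ?inE ?ac //.
rewrite (@wsumD1 _ _ _ (S :\ c :\ a) _ d) ?inE ?dS ?[d == a]eq_sym ?ad ?[d == c]eq_sym ?cd //.
rewrite (wsumD1 _ _ bS') -/T hT.
rewrite !(crossing_otherend _ id, crossing_otherend _ ic, crossing_otherend _ ia, crossing_otherend _ ib).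
move: hY; rewrite !inE AY CY DY eqxx (negPf Bx) !orbT /=.
by move: (wsum _ _ _) => r; case: (_ \in Y); clear; lia.
Qed.

(** * Lifting even edge sets through a splice *)

Lemma incidentE (V E : finType) (ends : E -> V * V) e x :
  incident ends e x = (0 < endcount x (ends e)).
Proof. by rewrite /incident /endcount ![x == _]eq_sym; do 2!case: (_ == x). Qed.

Lemma endcount_nonloop (V E : finType) (ends : E -> V * V) e x :
  (ends e).1 != (ends e).2 -> endcount x (ends e) = incident ends e x.
Proof.
rewrite /incident /endcount ![x == _]eq_sym => ne.
by case: eqP => [<-|_]; rewrite ?[_.2 == _]eq_sym ?(negPf ne).
Qed.

Lemma wsum_endcount (V E : finType) (ends : E -> V * V) (S : {set E}) x :
  (forall e, e \in S -> (ends e).1 != (ends e).2) ->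
  wsum ends S (endcount x) = #|[set e in S | incident ends e x]|.
Proof.
move=> nl; rewrite /wsum -sum1_card big_mkcond /=.
rewrite [RHS]big_mkcond /=; apply: eq_bigr => e _; rewrite inE.
by case eS: (e \in S) => //=; rewrite endcount_nonloop ?nl //; case: incident.
Qed.

Lemma otherend_neq (V E : finType) (ends : E -> V * V) e x :
  (ends e).1 != (ends e).2 -> otherend ends e x != x.
Proof.
by rewrite /otherend => ne; case: ifP => [/eqP<-|/negbT//]; rewrite eq_sym.
Qed.

Lemma incident_otherend (V E : finType) (ends : E -> V * V) e x :
  incident ends e (otherend ends e x).
Proof. by rewrite /incident /otherend; case: ifP; rewrite eqxx ?orbT. Qed.

Lemma incident_pair (V E : finType) (ends : E -> V * V) e x y :
  incident ends e x -> incident ends e y = (y == x) || (y == otherend ends e x).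
Proof.
rewrite /incident /otherend; case: (eqVneq x (ends e).1) => [->|_] //=.
by move/eqP->; rewrite orbC.
Qed.

Lemma wsum_pos (V E : finType) (ends : E -> V * V) (Z : {set E}) e v :
  e \in Z -> incident ends e v -> 0 < wsum ends Z (endcount v).
Proof. by move=> eZ; rewrite incidentE (wsumD1 _ _ eZ) => h; rewrite addn_gt0 h. Qed.

Lemma wsum_subset (V E : finType) (ends : E -> V * V) (Y Z : {set E}) w :
  Y \subset Z -> wsum ends Y w <= wsum ends Z w.
Proof.
move=> YZ; rewrite /wsum [leqRHS](bigID (mem Y)) /=.
rewrite (eq_bigl (fun e => (e \in Z) && (e \in Y))) ?leq_addr // => e.
by case eY: (e \in Y); rewrite ?andbF // (subsetP YZ).
Qed.

Lemma wsumU1 (V E : finType) (ends : E -> V * V) (Z : {set E}) w e :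
  e \notin Z -> wsum ends (e |: Z) w = w (ends e) + wsum ends Z w.
Proof. by move=> eZ; rewrite (wsumD1 _ _ (setU11 e Z)) setU1K. Qed.

Lemma endcount_splice (V E : finType) (ends : E -> V * V) (T : {set E}) x a c v :
  incident ends a x -> incident ends c x -> a \in T -> c \notin T ->
  wsum ends (c |: T) (endcount v) =
  wsum (splice ends x a c) T (endcount v) + (x == v).*2.
Proof.
move=> ia ic aT cT; rewrite wsumU1 // wsum_upd // (wsumD1 _ _ aT).
rewrite (endcount_otherend _ ia) (endcount_otherend _ ic) /endcount /=; clear; lia.
Qed.

(** If [Z] uses the spliced edge, replace it by the path [a], [c]. This adds 2 to the degree of [x],
    so parities are kept and no degree decreases. *)
Lemma splice_lift (V E : finType) (ends : E -> V * V) (S Z : {set E}) x a c :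
  incident ends a x -> incident ends c x -> a \in S -> c \in S -> a != c ->
  Z \subset S :\ c ->
  (forall v, ~~ odd (wsum (splice ends x a c) Z (endcount v))) ->
  exists Z' : {set E}, [/\ [/\ Z' \subset S, Z \subset Z' & a \in Z -> c \in Z'],
    forall v, ~~ odd (wsum ends Z' (endcount v)) &
    forall v, wsum (splice ends x a c) Z (endcount v) <= wsum ends Z' (endcount v)].
Proof.
move=> ia ic aS cS ac ZS ev.
have cZ : c \notin Z by apply/negP => /(subsetP ZS); rewrite !inE eqxx.
have ZS' : Z \subset S by apply: subset_trans ZS (subsetDl _ _).
case aZ: (a \in Z); last first.
  exists Z; split=> // v.
    by have := ev v; rewrite wsum_upd_notin ?aZ.
  by rewrite wsum_upd_notin ?aZ.
exists (c |: Z); split.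
- by rewrite subUset sub1set cS ZS' subsetUr setU11.
- by move=> v; rewrite (endcount_splice _ ia ic) // oddD odd_double addbF.
- by move=> v; rewrite (endcount_splice _ ia ic) // leq_addr.
Qed.

Lemma endcount_splice_other (V E : finType) (ends : E -> V * V) (S : {set E}) x a c v :
  incident ends a x -> incident ends c x -> a \in S -> c \in S -> a != c -> x != v ->
  wsum (splice ends x a c) (S :\ c) (endcount v) = wsum ends S (endcount v).
Proof.
move=> ia ic aS cS ac /negPf xv.
rewrite -[in RHS](setD1K cS) (endcount_splice _ ia ic) ?inE ?eqxx ?ac //.
by rewrite xv addn0.
Qed.

(** * Contracting an edge *)

(** The vertex [u] remains, isolated if [u != w], and the edges between [u] and [w] become loops, so
    vertex and edge types do not change. *)
Definition contract (V E : finType) (ends : E -> V * V) (u w : V) : E -> V * V :=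
  let k v := if v == u then w else v in fun e => (k (ends e).1, k (ends e).2).

(** A cut of the contracted graph is a cut of the original graph that does not separate [u] from
    [w]. *)
Lemma bridgeless_contract (V E : finType) (ends : E -> V * V) (S : {set E}) u w :
  bridgeless ends S -> bridgeless (contract ends u w) S.
Proof.
move=> /bridgelessP bl; apply/bridgelessP => X.
have := bl [set v | (if v == u then w else v) \in X]; congr (_ <> _).
by apply: eq_bigr => e _; rewrite /crossing !inE.
Qed.

Lemma bridgeless_loop (V E : finType) (ends : E -> V * V) (S : {set E}) e :
  (ends e).1 = (ends e).2 -> bridgeless ends S -> bridgeless ends (S :\ e).
Proof.
move=> le /bridgelessP bl; apply/bridgelessP => X; have := bl X.
case eS: (e \in S); last by rewrite (setDidPl _) // disjoint_sym disjoints1 eS.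
by rewrite (wsumD1 _ _ eS) {1}/crossing le addbb.
Qed.

Lemma endcount_contract (V E : finType) (ends : E -> V * V) (Z : {set E}) u w v :
  u != w -> v != u -> 
  wsum (contract ends u w) Z (endcount v) =
  wsum ends Z (endcount v) + (v == w) * wsum ends Z (endcount u).
Proof.
move=> uw vu; rewrite /wsum big_distrr -big_split; apply: eq_bigr => e _ /=.
rewrite /endcount /contract /=.
have h z : ((if z == u then w else z) == v) = (z == v) + (v == w) * (z == u) :> nat.
  case: (eqVneq z u) => [->|_]; last by rewrite muln0 addn0.
  by rewrite muln1 [u == v]eq_sym (negPf vu) eq_sym.
by rewrite !h mulnDr addnACA.
Qed.

(** The degrees of [u] and [w] in [Z] have an even sum; if both are odd, adding [e] repairs them. *)
Lemma contract_lift (V E : finType) (ends : E -> V * V) (Z : {set E}) u w e :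
  u != w -> incident ends e u -> otherend ends e u = w -> e \notin Z ->
  (forall v, ~~ odd (wsum (contract ends u w) Z (endcount v))) ->
  exists Z' : {set E}, [/\ Z' \subset e |: Z, Z \subset Z' &
    forall v, ~~ odd (wsum ends Z' (endcount v))].
Proof.
move=> uw ie ew eZ ev.
have evw : ~~ odd (wsum ends Z (endcount w) + wsum ends Z (endcount u)).
  have wu : w != u by rewrite eq_sym.
  by have := ev w; rewrite endcount_contract // eqxx mul1n.
have evv v : v != u -> v != w -> ~~ odd (wsum ends Z (endcount v)).
  by move=> vu vw; have := ev v; rewrite endcount_contract // (negPf vw) addn0.
case: (boolP (odd (wsum ends Z (endcount u)))) => ou; last first.
  exists Z; split=> //; first exact: subsetUr.
  move=> v; case: (eqVneq v u) => [-> //|vu]; case: (eqVneq v w) => [->|]; last exact: evv.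
  by move: evw; rewrite oddD (negPf ou) addbF.
exists (e |: Z); split=> //; first exact: subsetUr.
move=> v; rewrite wsumU1 // (endcount_otherend _ ie) ew.
case: (eqVneq v u) => [->|vu].
  by rewrite eq_sym (negPf uw) /= ou.
case: (eqVneq v w) => [->|vw].
  by move: evw; rewrite !oddD ou /= addbT.
exact: evv.
Qed.

Lemma bridgeless_degree_neq1 (V E : finType) (ends : E -> V * V) (S : {set E}) v :
  (forall e, e \in S -> (ends e).1 != (ends e).2) -> bridgeless ends S ->
  wsum ends S (endcount v) <> 1.
Proof.
move=> nl /bridgelessP /(_ [set v]); congr (_ <> _); apply: eq_wsum => e /nl.
by rewrite /crossing /endcount !inE; case: (eqVneq _.1 v) => [->|_]; case: eqVneq.
Qed.

(** * Covering even subgraphs with a prescribed edge *)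

(** The last clause is conditional so that the statement still makes sense after the label [l]
    itself has been deleted. *)
Definition has_cover (V E : finType) (ends : E -> V * V) (S : {set E}) (l : E) : Prop :=
  exists Z : {set E},
    [/\ Z \subset S, forall v, ~~ odd (wsum ends Z (endcount v)),
        forall v, 2 < wsum ends S (endcount v) -> 0 < wsum ends Z (endcount v) &
        l \in S -> l \in Z].

Lemma has_cover_loop (V E : finType) (ends : E -> V * V) (S : {set E}) g l :
  g \in S -> (ends g).1 = (ends g).2 -> has_cover ends (S :\ g) l -> has_cover ends S l.
Proof.
move=> gS lg [Z [ZS ev cov lZ]].
have gZ : g \notin Z by apply/negP => /(subsetP ZS); rewrite !inE eqxx.
have eg v : endcount v (ends g) = ((ends g).1 == v).*2 by rewrite /endcount -lg addnn.
exists (g |: Z); split.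
- by rewrite subUset sub1set gS (subset_trans ZS (subsetDl _ _)).
- by move=> v; rewrite wsumU1 // eg oddD odd_double; apply: ev.
- move=> v; rewrite wsumU1 // (wsumD1 _ _ gS) eg; case: eqP => [//|_].
  exact: cov.
- by move: lZ; rewrite !inE; case: eqP => //= _ h /h ->; rewrite ?orbT.
Qed.

(** Suppresses a vertex of degree 2. The label [q] disappears, so if it was prescribed its role
    passes to [p]. *)
Lemma has_cover_splice2 (V E : finType) (ends : E -> V * V) (S : {set E}) x p q l :
  p \in S -> q \in S -> p != q -> incident ends p x -> incident ends q x ->
  wsum ends S (endcount x) = 2 ->
  has_cover (splice ends x p q) (S :\ q) (if l == q then p else l) ->
  has_cover ends S l.
Proof.
move=> pS qS pq ip iq dx [Z [ZS ev cov lZ]].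
have [Z' [[Z'S ZZ' pZ] ev' le]] := splice_lift ip iq pS qS pq ZS ev.
exists Z'; split=> //.
  move=> v dv; apply: leq_trans (le v); apply: cov.
  rewrite endcount_splice_other //; apply/eqP => xv; by rewrite -xv dx in dv.
move: lZ; case: (eqVneq l q) => [->|lq]; rewrite !inE.
  by rewrite pq pS => /(_ isT) /pZ.
by rewrite lq => h /h /(subsetP ZZ').
Qed.

(** The vertex [x] is left out because the splice lowers its degree by 2; that [Z] contains both [a]
    and [c] makes up for it. *)
Lemma has_cover_splice (V E : finType) (ends : E -> V * V) (S : {set E}) x a c :
  a \in S -> c \in S -> a != c -> incident ends a x -> incident ends c x ->
  has_cover (splice ends x a c) (S :\ c) a ->
  exists Z : {set E}, [/\ [/\ Z \subset S, a \in Z & c \in Z],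
    forall v, ~~ odd (wsum ends Z (endcount v)) &
    forall v, v != x -> 2 < wsum ends S (endcount v) -> 0 < wsum ends Z (endcount v)].
Proof.
move=> aS cS ac ia ic [Z [ZS ev cov aZ]].
have [Z' [[Z'S ZZ' cZ] ev' le]] := splice_lift ia ic aS cS ac ZS ev.
have {}aZ : a \in Z by apply: aZ; rewrite !inE ac.
exists Z'; split=> //; first by split=> //; [apply: (subsetP ZZ')|apply: cZ].
move=> v; rewrite eq_sym => xv dv; apply: leq_trans (le v); apply: cov.
by rewrite endcount_splice_other.
Qed.

(** Among three further edges at [u] one can be spliced with [a], and after lifting [a] covers
    [u]. *)
Lemma has_cover_degree_ge4 (V E : finType) (ends : E -> V * V) (S : {set E}) a u :
  bridgeless ends S -> a \in S -> incident ends a u ->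
  3 < #|[set e in S | incident ends e u]| ->
  (forall c, c \in S -> bridgeless (splice ends u a c) (S :\ c) ->
     has_cover (splice ends u a c) (S :\ c) a) ->
  has_cover ends S a.
Proof.
move=> bl aS ia; rewrite (cardsD1 a) inE aS ia /= => h IH.
have [c [d [e [[]]]]] := card_gt2P h; rewrite !inE.
move=> /and3P[ca cS ic] /and3P[da dS id] /and3P[ea eS ie] [cd de ec].
have [//||g] := @splice_one_of_three _ _ ends S u a c d e bl.
- by rewrite /= !inE !negb_or ![a == _]eq_sym ca da ea cd de [c == e]eq_sym ec.
- by move=> g; rewrite !inE => /or4P[]/eqP->.
move=> gin blg.
have [gS gu ga] : [/\ g \in S, incident ends g u & a != g].
  by move: gin; rewrite [a == g]eq_sym !inE => /or3P[]/eqP->.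
have [Z [[ZS aZ gZ] ev cov]] := has_cover_splice aS gS ga ia gu (IH _ gS blg).
exists Z; split=> // v dv.
case: (eqVneq v u) => [->|vu]; last exact: cov.
exact: wsum_pos aZ ia.
Qed.

Lemma incident_contract (V E : finType) (ends : E -> V * V) u w e :
  u != w -> incident (contract ends u w) e w = incident ends e w || incident ends e u.
Proof.
move=> uw; rewrite /incident /contract /= ![w == _]eq_sym ![u == _]eq_sym.
by do 2!(case: (eqVneq _ u) => [->|_]; rewrite ?eqxx ?(negPf uw) ?orbT ?orbF //=).
Qed.

Lemma contract_loop (V E : finType) (ends : E -> V * V) u w e :
  incident ends e u -> otherend ends e u = w ->
  (contract ends u w e).1 = (contract ends u w e).2.
Proof.
rewrite /incident /otherend /contract /= ![u == _]eq_sym.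
case: ((ends e).1 == u) => /=; first by move=> _ ->; case: ifP.
by move=> -> ->.
Qed.

(** Contract the parallel edges [p], [q] and drop the loops they become. The lift uses [p] at most,
    and [a] covers [u]. *)
Lemma has_cover_parallel (V E : finType) (ends : E -> V * V) (S : {set E}) a p q u w :
  (forall e, e \in S -> (ends e).1 != (ends e).2) ->
  bridgeless ends S -> uniq [:: a; p; q] ->
  (forall g, (g \in S) && incident ends g u = (g \in [:: a; p; q])) ->
  otherend ends p u = w -> otherend ends q u = w ->
  (bridgeless (contract ends u w) (S :\ p :\ q) ->
     has_cover (contract ends u w) (S :\ p :\ q) a) ->
  has_cover ends S a.
Proof.
move=> nl bl uq h pw qw IH.
have h' g : g \in [:: a; p; q] -> g \in S /\ incident ends g u.
  by rewrite -h => /andP.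
have [aS ia] : a \in S /\ incident ends a u by apply: h'; rewrite !inE eqxx.
have [pS ip] : p \in S /\ incident ends p u by apply: h'; rewrite !inE eqxx ?orbT.
have [qS iq] : q \in S /\ incident ends q u by apply: h'; rewrite !inE eqxx ?orbT.
have uw : u != w by rewrite eq_sym -pw otherend_neq ?nl.
have [|Z [ZS ev cov aZ]] := IH.
  do 2!(apply: bridgeless_loop; first exact: contract_loop).
  exact: bridgeless_contract.
move: uq; rewrite /= !inE !negb_or !andbT => /andP[/andP[ap aq] pq].
have {}aZ : a \in Z by apply: aZ; rewrite !inE ap aq aS.
have pZ : p \notin Z by apply/negP => /(subsetP ZS); rewrite !inE eqxx !andbF.
have qZ : q \notin Z by apply/negP => /(subsetP ZS); rewrite !inE eqxx.
have [Z' [Z'Z ZZ' ev']] := contract_lift uw ip pw pZ ev.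
have Z'S : Z' \subset S.
  apply: subset_trans Z'Z _; rewrite subUset sub1set pS.
  by apply: subset_trans ZS _; rewrite !subDset; apply/subsetP => g gS; rewrite !inE gS !orbT.
have aZ' : a \in Z' by apply: (subsetP ZZ').
(* The degree of [u] is even and [a] is present while [q] is not, so [p] must be; it covers [w]. *)
have pZ' : p \in Z'.
  have := ev' u; rewrite wsum_endcount; last by move=> e /(subsetP Z'S) /nl.
  apply: contraR => pnZ'.
  have -> : [set e in Z' | incident ends e u] = [set a].
    apply/setP => g; rewrite !inE; apply/andP/eqP => [[gZ' ig]|-> //].
    have := h g; rewrite (subsetP Z'S _ gZ') ig !inE => /esym/or3P[]/eqP // gg.
      by rewrite -gg gZ' in pnZ'.
    move: (subsetP Z'Z _ gZ'); rewrite gg !inE eq_sym (negPf pq) /=.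
    by rewrite (negPf qZ).
  by rewrite cards1.
exists Z'; split=> //.
move=> v dv; case: (eqVneq v u) => [->|vu]; first exact: wsum_pos aZ' ia.
case: (eqVneq v w) => [->|vw].
  by apply: wsum_pos pZ' _; rewrite -pw incident_otherend.
apply: leq_trans (wsum_subset _ _ ZZ').
have := cov v; rewrite !endcount_contract // (negPf vw) !addn0; apply.
rewrite (wsumD1 _ _ pS) (@wsumD1 _ _ _ _ _ q) ?inE ?qS ?[q == _]eq_sym ?pq // in dv.
move: dv; rewrite (endcount_otherend _ ip) (endcount_otherend _ iq) pw qw.
by rewrite ![_ == v]eq_sym (negPf vu) (negPf vw).
Qed.

(** Contract [e] and splice [a] with an edge [c] coming from [w]. In the lift [a] covers [u] and [c]
    covers [w], while [e] is added if parity requires it. *)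
Lemma has_cover_degree3 (V E : finType) (ends : E -> V * V) (S : {set E}) a b e u w :
  (forall e, e \in S -> (ends e).1 != (ends e).2) ->
  bridgeless ends S -> uniq [:: a; b; e] ->
  (forall g, (g \in S) && incident ends g u = (g \in [:: a; b; e])) ->
  otherend ends e u = w -> otherend ends a u != w -> otherend ends b u != w ->
  2 < #|[set e in S | incident ends e w]| ->
  (forall c, c \in S :\ e -> bridgeless (splice (contract ends u w) w a c) (S :\ e :\ c) ->
     has_cover (splice (contract ends u w) w a c) (S :\ e :\ c) a) ->
  has_cover ends S a.
Proof.
move=> nl bl uq h ew aw bw dw IH.
have h' g : g \in [:: a; b; e] -> g \in S /\ incident ends g u.
  by rewrite -h => /andP.
have [aS ia] : a \in S /\ incident ends a u by apply: h'; rewrite !inE eqxx.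
have [bS ib] : b \in S /\ incident ends b u by apply: h'; rewrite !inE eqxx ?orbT.
have [eS ie] : e \in S /\ incident ends e u by apply: h'; rewrite !inE eqxx ?orbT.
have uw : u != w by rewrite eq_sym -ew otherend_neq ?nl.
move: uq; rewrite /= !inE !negb_or !andbT => /andP[/andP[ab ae] be].
set H := contract ends u w.
have iw : incident ends e w by rewrite -ew incident_otherend.
have naw : ~~ incident ends a w.
  by rewrite (incident_pair _ ia) eq_sym (negPf uw) eq_sym.
have nbw : ~~ incident ends b w.
  by rewrite (incident_pair _ ib) eq_sym (negPf uw) eq_sym.
have blH : bridgeless H (S :\ e).
  by apply: bridgeless_loop; [apply: contract_loop|apply: bridgeless_contract].
have iHa : incident H a w by rewrite incident_contract // ia orbT.
have iHb : incident H b w by rewrite incident_contract // ib orbT.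
have [c [cS ec icw blc]] : exists c, [/\ c \in S, c != e, incident ends c w &
    bridgeless (splice H w a c) (S :\ e :\ c)].
  move: dw; rewrite (cardsD1 e) inE eS iw add1n ltnS.
  set N := _ :\ e => N1.
  have inN c : c \in N -> [/\ c \in S, c != e & incident ends c w].
    by rewrite !inE => /and3P[].
  have nN c : c \in N -> (a != c) && (b != c).
    move/inN => [_ _ ic]; apply/andP; split; apply/eqP => cc.
      by rewrite cc ic in naw.
    by rewrite cc ic in nbw.
  (* The partner [c] must come from [w], since splicing [a] with [b] could leave [w] uncovered. With
     three candidates one works; with only two, the merged vertex has exactly the four edges [a],
     [b], [c], [d]. *)
  have [N2|N2] := ltnP 2 #|N|.
    have [c [d [f [[cN dN fN] [cd df fc]]]]] := card_gt2P N2.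
    have /andP[ac _] := nN _ cN; have /andP[ad _] := nN _ dN; have /andP[af _] := nN _ fN.
    have [||g] := @splice_one_of_three _ _ H (S :\ e) w a c d f blH.
    - by rewrite /= !inE !negb_or ac ad af cd df [c == f]eq_sym fc.
    - move=> g; rewrite inE => /predU1P[->|gg]; first by rewrite !inE ae.
      have /inN[gS ge ig] : g \in N by move: gg; rewrite !in_cons orbF => /or3P[]/eqP->.
      by rewrite !inE ge gS incident_contract ?ig.
    - move=> gg blg; exists g.
      by have /inN[] : g \in N by move: gg; rewrite !in_cons orbF => /or3P[]/eqP->.
  have /cards2P[c [d [cd Ncd]]] : #|N| == 2 by rewrite eqn_leq N2.
  have cN : c \in N by rewrite Ncd !inE eqxx.
  have dN : d \in N by rewrite Ncd !inE eqxx orbT.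
  have /andP[ac bc] := nN _ cN; have /andP[ad bd] := nN _ dN.
  have [|||g] := @splice_degree_four _ _ H (S :\ e) w a b c d blH.
  - by rewrite /= !inE !negb_or ab ac ad bc bd cd.
  - move=> g; rewrite incident_contract // andb_orr.
    have -> : (g \in S :\ e) && incident ends g w = (g \in N) by rewrite !inE -!andbA.
    have -> : (g \in S :\ e) && incident ends g u = (g \in [:: a; b]).
      rewrite in_setD1 -andbA h !in_cons !orbF; case: (eqVneq g e) => [->|_] //=.
        by rewrite eq_sym (negPf ae) eq_sym (negPf be).
      by rewrite orbF.
    by rewrite Ncd !inE orbC -!orbA.
  - rewrite /H /otherend /contract /=; move: ib bw (nl _ bS) nbw.
    rewrite /incident /otherend negb_or ![w == _]eq_sym ![u == _]eq_sym.
    case: (eqVneq (ends b).1 u) => [->|b1] /=.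
      by rewrite eqxx => _ bw; rewrite eq_sym => /negPf->.
    by move=> /eqP b2 _ _ /andP[/negPf b1w _]; rewrite b1w b1w.
  - move=> gg blg; exists g.
    by have /inN[] : g \in N by move: gg; rewrite !in_cons orbF => /orP[]/eqP->.
have ac : a != c by apply/eqP => cc; rewrite cc icw in naw.
have iHc : incident H c w by rewrite incident_contract // icw.
have aSe : a \in S :\ e by rewrite !inE ae.
have cSe : c \in S :\ e by rewrite !inE ec.
have [Z [[ZS aZ cZ] ev cov]] := has_cover_splice aSe cSe ac iHa iHc (IH _ cSe blc).
have eZ : e \notin Z by apply/negP => /(subsetP ZS); rewrite !inE eqxx.
have [Z' [Z'Z ZZ' ev']] := contract_lift uw ie ew eZ ev.
exists Z'; split=> //.
- apply: subset_trans Z'Z _; rewrite subUset sub1set eS.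
  exact: subset_trans ZS (subsetDl _ _).
- move=> v dv; apply: leq_trans (wsum_subset _ _ ZZ').
  case: (eqVneq v u) => [->|vu]; first exact: wsum_pos aZ ia.
  case: (eqVneq v w) => [->|vw]; first exact: wsum_pos cZ icw.
  have := cov v vw; rewrite !endcount_contract // (negPf vw) !addn0; apply.
  move: dv; rewrite (wsumD1 _ _ eS) (endcount_otherend _ ie) ew.
  by rewrite ![_ == v]eq_sym (negPf vu) (negPf vw).
- by move=> _; apply: (subsetP ZZ').
Qed.

(** Induction on the number of edges: remove loops, suppress vertices of degree 2, then reduce at an
    end [u] of the prescribed edge according to its degree. *)
Theorem covering_even_subgraph (V E : finType) (ends : E -> V * V) (S : {set E}) (l : E) :
  bridgeless ends S -> has_cover ends S l.
Proof.
move: {2}#|S|.+1 (ltnSn #|S|) => n; elim: n ends S l => // n IH ends S l Sn bl.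
have ltD1 g : g \in S -> #|S :\ g| < n.
  by move=> gS; move: Sn; rewrite (cardsD1 g S) gS.
have ltD2 g k : g \in S -> #|S :\ g :\ k| < n.
  by move=> gS; apply: leq_ltn_trans (ltD1 _ gS); apply/subset_leq_card/subsetDl.
case: (pickP [pred g in S | (ends g).1 == (ends g).2]) => [g /andP[gS /eqP lg]|nl].
  by apply: (has_cover_loop gS lg); apply: IH; [exact: ltD1|exact: bridgeless_loop].
have {}nl e : e \in S -> (ends e).1 != (ends e).2.
  by move=> eS; have := nl e; rewrite /= eS /= => ->.
case: (pickP [pred v | #|[set e in S | incident ends e v]| == 2]) => [x /= dx2|nd2].
  have dx : wsum ends S (endcount x) = 2 by rewrite wsum_endcount //; apply/eqP.
  have /cards2P[p [q [pq Npq]]] := dx2.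
  have : p \in [set e in S | incident ends e x] by rewrite Npq !inE eqxx.
  rewrite inE => /andP[pS ip].
  have : q \in [set e in S | incident ends e x] by rewrite Npq !inE eqxx orbT.
  rewrite inE => /andP[qS iq].
  apply: (has_cover_splice2 pS qS pq ip iq dx); apply: IH; first exact: ltD1.
  case bm: (bridgeless _ _) => //.
  (* Adding [x] to a bad set [X] puts [p] and [q] inside and affects no other edge, so the bridge
     would have existed before. *)
  have [X [xX PX QX hX]] := splice_bad bl pS qS pq ip iq (negbT bm).
  have/bridgelessP/(_ (x |: X)) := bl.
  rewrite (wsumD1 _ _ qS) (@wsumD1 _ _ _ _ _ p) ?inE ?pq //.
  rewrite (crossing_otherend _ ip) (crossing_otherend _ iq) !inE eqxx PX QX !orbT /=.
  rewrite !add0n -[X in _ <> X]hX; case; apply: eq_wsum => g.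
  rewrite !inE => /and3P[gp gq gS].
  have : g \notin [set e in S | incident ends e x] by rewrite Npq !inE (negPf gp) (negPf gq).
  rewrite inE gS /incident /= negb_or => /andP[g1 g2].
  by rewrite /crossing !inE ![_ == x]eq_sym (negPf g1) (negPf g2).
(* If [l] is not an edge in use, any other edge may be prescribed instead. *)
suff main a : a \in S -> has_cover ends S a.
  case lS: (l \in S); first exact: main.
  case: (set_0Vmem S) => [S0|[a /main[Z [ZS ev cov _]]]]; last first.
    by exists Z; split=> //; rewrite lS.
  exists set0; split; rewrite ?sub0set ?lS //.
    by move=> v; rewrite /wsum big_set0.
  by move=> v; rewrite /wsum S0 big_set0.
move=> aS; pose u := (ends a).2.
have ia : incident ends a u by rewrite /incident eqxx orbT.
(* Degree 1 would give a bridge, and degree 2 has been dealt with. *)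
have dge3 v g : g \in S -> incident ends g v -> 2 < #|[set e in S | incident ends e v]|.
  move=> gS gv; have := @bridgeless_degree_neq1 _ _ _ _ v nl bl; rewrite wsum_endcount //.
  have := nd2 v; rewrite /=; set k := #|_|.
  have : 0 < k by apply/card_gt0P; exists g; rewrite inE gS gv.
  by case: k => [|[|[|k]]].
have [d4|d3] := ltnP 3 #|[set e in S | incident ends e u]|.
  apply: (has_cover_degree_ge4 bl aS ia d4) => c cS blc; apply: IH => //.
  exact: ltD1.
have : #|[set e in S | incident ends e u] :\ a| == 2.
  by move: d3 (dge3 _ _ aS ia); rewrite (cardsD1 a) inE aS ia /=; case: #|_| => [|[|[|]]].
case/cards2P => p [q [pq Npq]].
have mem g : (g \in S) && incident ends g u = (g \in [:: a; p; q]).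
  move/setP/(_ g): Npq; rewrite !inE; case: (eqVneq g a) => [->|//] _.
  by rewrite aS ia.
have ap : a != p.
  by move/setP/(_ p): Npq; rewrite !inE eqxx eq_sym; case: eqP.
have aq : a != q.
  by move/setP/(_ q): Npq; rewrite !inE eqxx orbT eq_sym; case: eqP.
have uq : uniq [:: a; p; q] by rewrite /= !inE negb_or ap aq pq.
have pS : p \in S by have := mem p; rewrite !inE eqxx orbT => /andP[].
have ip : incident ends p u by have := mem p; rewrite !inE eqxx orbT => /andP[].
have qS : q \in S by have := mem q; rewrite !inE eqxx !orbT => /andP[].
have iq : incident ends q u by have := mem q; rewrite !inE eqxx !orbT => /andP[].
have deg3 b e : uniq [:: a; b; e] ->
    (forall g, (g \in S) && incident ends g u = (g \in [:: a; b; e])) ->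
    otherend ends b u != otherend ends e u ->
    otherend ends a u != otherend ends e u -> has_cover ends S a.
  move=> uq' mem' bw aw.
  have eS : e \in S by have := mem' e; rewrite !inE eqxx !orbT => /andP[].
  apply: (has_cover_degree3 nl bl uq' mem' erefl aw bw).
    by apply: dge3 eS _; apply: incident_otherend.
  by move=> c cS blc; apply: IH => //; apply: ltD2.
case: (eqVneq (otherend ends p u) (otherend ends q u)) => [Epq|Npq'].
  apply: (has_cover_parallel nl bl uq mem erefl (esym Epq)) => blc.
  by apply: IH => //; apply: ltD2.
(* The far ends of [p] and [q] differ, so one of these edges is not parallel to [a]; that one is
   contracted. *)
case: (eqVneq (otherend ends a u) (otherend ends q u)) => [Eaq|Naq]; last exact: (deg3 p q).
apply: (deg3 q p).
- by rewrite /= !inE negb_or ap aq eq_sym pq.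
- by move=> g; rewrite mem !inE [(g == q) || _]orbC.
- by rewrite eq_sym.
- by rewrite Eaq eq_sym.
Qed.

(** * Balanced colourings *)

(* In a signed graph the two ends of [e] receive the same colour if [sgn e], and
   opposite colours otherwise: an edge obtained by splicing stands for an
   alternating trail, and [sgn] records the parity of its length. *)
Definition odd_inside (V E : finType) (ends : E -> V * V) (sgn : E -> bool)
  (S : {set E}) (X : {set V}) : nat := \sum_(e in S) (sgn e && ((ends e).1 \in X)).

(** A set that no edge crosses is a union of components, and an edge lies inside it as soon as its
    first end does. So every component has evenly many edges with [sgn] true. *)
Definition closed_even (V E : finType) (ends : E -> V * V) (sgn : E -> bool)
  (S : {set E}) : bool :=
  [forall X : {set V}, (wsum ends S (crossing X) == 0) ==> ~~ odd (odd_inside ends sgn S X)].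

Definition splice_sgn (E : finType) (sgn : E -> bool) (a c : E) : E -> bool :=
  fun e => if e == a then sgn a (+) sgn c else sgn e.

(* [c e] is the colour of [e] at its first end. *)
Definition true_ends (V E : finType) (ends : E -> V * V) (sgn c : E -> bool) (e : E) (v : V) : nat :=
  (((ends e).1 == v) && c e) + (((ends e).2 == v) && (c e (+) ~~ sgn e)).

Definition balanced (V E : finType) (ends : E -> V * V) (sgn : E -> bool)
  (S : {set E}) (c : E -> bool) : Prop :=
  forall v, (\sum_(e in S) true_ends ends sgn c e v).*2 = wsum ends S (endcount v).

Lemma odd_insideD1 (V E : finType) (ends : E -> V * V) sgn (S : {set E}) X a :
  a \in S ->
  odd_inside ends sgn S X = (sgn a && ((ends a).1 \in X)) + odd_inside ends sgn (S :\ a) X.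
Proof. by move=> aS; rewrite /odd_inside (big_setD1 a). Qed.

Lemma odd_inside_splice (V E : finType) (ends : E -> V * V) sgn (S : {set E}) X x a c :
  a \in S -> c \in S -> a != c ->
  odd_inside (splice ends x a c) (splice_sgn sgn a c) (S :\ c) X =
  ((sgn a (+) sgn c) && (otherend ends a x \in X)) + odd_inside ends sgn (S :\ c :\ a) X.
Proof.
move=> aS cS ac; rewrite (@odd_insideD1 _ _ _ _ _ _ a) ?inE ?ac //.
rewrite /splice_sgn /splice /upd eqxx /=; congr (_ + _).
by apply: eq_bigr => e; rewrite !inE => /andP[/negPf-> _].
Qed.

Lemma wsum_splice (V E : finType) (ends : E -> V * V) (S : {set E}) w x a c :
  a \in S -> c \in S -> a != c ->
  wsum (splice ends x a c) (S :\ c) w =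
  w (otherend ends a x, otherend ends c x) + wsum ends (S :\ c :\ a) w.
Proof. by move=> aS cS ac; rewrite wsum_upd // !inE ac. Qed.

Lemma fst_in_noncrossing (V E : finType) (ends : E -> V * V) e x (X : {set V}) :
  incident ends e x -> crossing X (ends e) = 0 -> ((ends e).1 \in X) = (x \in X).
Proof.
rewrite /incident /crossing; case: eqP => [-> //|_ /= /eqP->].
by do 2!case: (_ \in X).
Qed.

(** The parity analogue of [splice_bad]: if the spliced edge lay outside the bad set, that set would
    already be closed and odd before the splice. *)
Lemma splice_odd (V E : finType) (ends : E -> V * V) sgn (S : {set E}) x a c :
  closed_even ends sgn S -> a \in S -> c \in S -> a != c ->
  incident ends a x -> incident ends c x ->
  ~~ closed_even (splice ends x a c) (splice_sgn sgn a c) (S :\ c) ->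
  exists X : {set V}, [/\ x \notin X, otherend ends a x \in X,
     otherend ends c x \in X, wsum ends (S :\ c :\ a) (crossing X) = 0 &
     odd ((sgn a (+) sgn c) + odd_inside ends sgn (S :\ c :\ a) X)].
Proof.
move=> /forallP ce aS cS ac ia ic /forallPn[X0].
rewrite negb_imply negbK => /andP[/eqP cl0 od0].
have aSc : a \in S :\ c by rewrite !inE ac.
have [X [xX cl od]] : exists X : {set V}, [/\ x \notin X,
    wsum (splice ends x a c) (S :\ c) (crossing X) = 0 &
    odd (odd_inside (splice ends x a c) (splice_sgn sgn a c) (S :\ c) X)].
  case xX: (x \in X0); last by exists X0; rewrite xX.
  exists (~: X0); rewrite inE xX crossingC; split=> //.
  (* The total number of odd edges is even, so the complement of a bad set is bad too. *)
  have := ce setT; rewrite /wsum big1; last by move=> e _; rewrite /crossing !inE.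
  rewrite /= (odd_insideD1 _ _ _ cS) (odd_insideD1 _ _ _ aSc) !inE !andbT.
  move: od0; rewrite !odd_inside_splice // !inE.
  have -> : odd_inside ends sgn (S :\ c :\ a) setT =
      odd_inside ends sgn (S :\ c :\ a) X0 + odd_inside ends sgn (S :\ c :\ a) (~: X0).
    rewrite /odd_inside -big_split; apply: eq_bigr => e _ /=; rewrite !inE.
    by case: (sgn e); case: (_ \in X0).
  rewrite !oddD !oddb; case: (sgn a); case: (sgn c); case: (_ \in X0) => /=;
  by case: (odd _); case: (odd _).
move: cl od; rewrite wsum_splice // odd_inside_splice //.
move/eqP; rewrite addn_eq0 => /andP[/eqP cl1 /eqP cl2].
move: cl1; rewrite /crossing /= => cl1.
have {}cl1 : (otherend ends c x \in X) = (otherend ends a x \in X).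
  by move: cl1; do 2!case: (_ \in X).
case AX: (otherend ends a x \in X) => od.
  by exists X; split; rewrite ?cl1 // -[sgn a (+) sgn c]andbT.
have := ce X.
have ca : crossing X (ends a) = 0 by rewrite (crossing_otherend _ ia) AX (negPf xX).
have cc : crossing X (ends c) = 0 by rewrite (crossing_otherend _ ic) cl1 AX (negPf xX).
rewrite (wsumD1 _ _ cS) (wsumD1 _ _ aSc) ca cc cl2 /=.
rewrite (odd_insideD1 _ _ _ cS) (odd_insideD1 _ _ _ aSc).
rewrite (fst_in_noncrossing ia ca) (fst_in_noncrossing ic cc) (negPf xX) !andbF.
by move: od; rewrite andbF => ->.
Qed.

(** Colours are stored at the first end; this translates a colour [b] wanted at the end far from
    [x], whatever the orientation. *)
Lemma colour_from (V E : finType) (ends : E -> V * V) e x (b s : bool) :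
  incident ends e x ->
  exists c : bool, forall v,
    (((ends e).1 == v) && c) + (((ends e).2 == v) && (c (+) ~~ s)) =
    ((otherend ends e x == v) && b) + ((x == v) && (b (+) ~~ s)).
Proof.
rewrite /incident /otherend; case: (eqVneq x (ends e).1) => [->|_] /=.
  move=> _; exists (b (+) ~~ s) => v; rewrite addnC; congr (_ + _).
  by case: b; case: s.
by move/eqP->; exists b.
Qed.

(** Give [a] and [c] the colours of the spliced edge at their far ends. The sign rule then makes
    their colours at [x] opposite. *)
Lemma balanced_splice (V E : finType) (ends : E -> V * V) sgn (S : {set E}) x a c k :
  a \in S -> c \in S -> a != c -> incident ends a x -> incident ends c x ->
  balanced (splice ends x a c) (splice_sgn sgn a c) (S :\ c) k ->
  exists k', balanced ends sgn S k'.
Proof.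
move=> aS cS ac ia ic bal.
have [ka hka] := colour_from (k a) (sgn a) ia.
have [kc hkc] := colour_from (k a (+) ~~ (sgn a (+) sgn c)) (sgn c) ic.
exists (fun e => if e == a then ka else if e == c then kc else k e) => v.
have aSc : a \in S :\ c by rewrite !inE ac.
rewrite (big_setD1 c cS) (big_setD1 a aSc) /=.
rewrite -[in RHS](setD1K cS) (endcount_splice _ ia ic) ?inE ?eqxx ?ac // -bal.
rewrite [in RHS](big_setD1 a aSc) /= -doubleD; congr _.*2.
rewrite /true_ends eqxx [c == a]eq_sym (negPf ac) eqxx hka hkc.
rewrite /splice_sgn /splice /upd eqxx /=.
set R := \sum_(_ in _) _; set R' := \sum_(_ in _) _.
have -> : R = R'.
  by apply: eq_bigr => e; rewrite !inE => /and3P[/negPf-> /negPf-> _].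
case: (sgn a); case: (sgn c); case: (k a); case: (x == v); case: (_ == v);
  case: (_ == v) => //=; clear; lia.
Qed.

Lemma balanced_loop (V E : finType) (ends : E -> V * V) sgn (S : {set E}) e k :
  e \in S -> (ends e).1 = (ends e).2 -> ~~ sgn e ->
  balanced ends sgn (S :\ e) k -> balanced ends sgn S k.
Proof.
move=> eS le /negPf se bal v; rewrite (big_setD1 e eS) (wsumD1 _ _ eS) -bal doubleD.
by congr (_ + _); rewrite /true_ends /endcount -le se; case: (k e); case: (_ == v).
Qed.

(** Splice edges at a vertex while keeping [closed_even], until an edge is alone at its vertex and
    is a loop that can be removed. *)
Lemma exists_balanced (V E : finType) (ends : E -> V * V) sgn (S : {set E}) :
  (forall v, ~~ odd (wsum ends S (endcount v))) -> closed_even ends sgn S ->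
  exists k, balanced ends sgn S k.
Proof.
move: {2}#|S|.+1 (ltnSn #|S|) => n; elim: n ends sgn S => // n IH ends sgn S Sn ev ce.
have ltD1 g : g \in S -> #|S :\ g| < n.
  by move=> gS; move: Sn; rewrite (cardsD1 g S) gS.
case: (set_0Vmem S) => [->|[e eS]].
  by exists xpredT => v; rewrite /wsum !big_set0.
pose x := (ends e).1.
have ie : incident ends e x by rewrite /incident eqxx.
have step f : f \in S -> e != f -> incident ends f x ->
    closed_even (splice ends x e f) (splice_sgn sgn e f) (S :\ f) ->
    exists k, balanced ends sgn S k.
  move=> fS ef jf ce'.
  have [|k] := IH _ _ _ (ltD1 _ fS) _ ce'.
    move=> v; have := ev v.
    rewrite -[in X in X -> _](setD1K fS) (endcount_splice _ ie jf) ?inE ?eqxx ?ef //.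
    by rewrite oddD odd_double addbF.
  exact: balanced_splice.
case: (pickP [pred f in S | (f != e) && incident ends f x]) => [f|none]; last first.
  have rest f : f \in S :\ e -> ~~ incident ends f x.
    by rewrite !inE => /andP[fe fS]; have := none f; rewrite /= fS fe /= => ->.
  (* The degree of [x] is even and comes from [e] alone, so [e] is a loop; as [[set x]] is closed,
     its sign is even. *)
  have le : (ends e).1 = (ends e).2.
    apply/eqP; have := ev x; rewrite (wsumD1 _ _ eS) /wsum big1; last first.
      by move=> f /rest; rewrite incidentE -eqn0Ngt => /eqP.
    by rewrite addn0; apply: contraR => /endcount_nonloop->; rewrite ie.
  have cle X : crossing X (ends e) = 0 by rewrite /crossing le addbb.
  have se : ~~ sgn e.
    have /forallP/(_ [set x]) := ce.
    rewrite (wsumD1 _ _ eS) cle (odd_insideD1 _ _ _ eS) inE eqxx andbT.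
    rewrite /wsum /odd_inside !big1 //.
    - by rewrite !addn0 eqxx oddb.
    - move=> f /rest; rewrite /incident negb_or eq_sym => /andP[/negPf f1 _].
      by rewrite inE f1 andbF.
    - move=> f /rest; rewrite /incident negb_or ![x == _]eq_sym => /andP[/negPf f1 /negPf f2].
      by rewrite /crossing !inE f1 f2.
  have [||k bk] := IH ends sgn _ (ltD1 _ eS).
  - move=> v; have := ev v; rewrite (wsumD1 _ _ eS) /endcount le addnn.
    by rewrite oddD odd_double.
  - apply/forallP => X; have /forallP/(_ X) := ce.
    by rewrite (wsumD1 _ _ eS) cle (odd_insideD1 _ _ _ eS) (negPf se).
  by exists k; apply: balanced_loop bk.
move=> /and3P[fS]; rewrite eq_sym => ef jf.
case cef: (closed_even (splice ends x e f) (splice_sgn sgn e f) (S :\ f)).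
  exact: step cef.
have [X [xX eX fX clX oX]] := splice_odd ce eS fS ef ie jf (negbT cef).
have eSf : e \in S :\ f by rewrite !inE ef.
case: (pickP [pred g in S | [&& g != e, g != f & incident ends g x]]) => [g|none]; last first.
  have rest g : g \in S :\ f :\ e -> ~~ incident ends g x.
    rewrite !inE => /and3P[ge gf gS]; have := none g; by rewrite /= gS ge gf /= => ->.
  (* With only [e] and [f] at [x], adding [x] to [X] gives a closed set with an odd count. *)
  have /forallP/(_ (x |: X)) := ce.
  rewrite (wsumD1 _ _ fS) (wsumD1 _ _ eSf) (odd_insideD1 _ _ _ fS) (odd_insideD1 _ _ _ eSf).
  have ke : crossing (x |: X) (ends e) = 0.
    by rewrite (crossing_otherend _ ie) !inE eqxx eX orbT.
  have kf : crossing (x |: X) (ends f) = 0.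
    by rewrite (crossing_otherend _ jf) !inE eqxx fX orbT.
  rewrite ke kf (fst_in_noncrossing ie ke) (fst_in_noncrossing jf kf) setU11 !andbT.
  have -> : wsum ends (S :\ f :\ e) (crossing (x |: X)) = 0.
    rewrite -clX; apply: eq_wsum => g /rest.
    rewrite /incident negb_or ![x == _]eq_sym => /andP[/negPf g1 /negPf g2].
    by rewrite /crossing !inE g1 g2.
  have -> : odd_inside ends sgn (S :\ f :\ e) (x |: X) = odd_inside ends sgn (S :\ f :\ e) X.
    apply: eq_bigr => g /rest.
    rewrite /incident negb_or ![x == _]eq_sym => /andP[/negPf g1 _].
    by rewrite !inE g1.
  move: oX; rewrite !oddD !oddb /=; case: (sgn e); case: (sgn f); by case: (odd _).
move=> /and4P[gS]; rewrite ![g == _]eq_sym => eg fg jg.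
case ceg: (closed_even (splice ends x e g) (splice_sgn sgn e g) (S :\ g)).
  exact: step ceg.
have [Y [xY eY gY clY _]] := splice_odd ce eS gS eg ie jg (negbT ceg).
have gSfe : g \in S :\ f :\ e by rewrite !inE gS [g == e]eq_sym eg [g == f]eq_sym fg.
have fSge : f \in S :\ g :\ e by rewrite !inE fS [f == e]eq_sym ef fg.
move: clX; rewrite (wsumD1 _ _ gSfe) => /eqP; rewrite addn_eq0 => /andP[/eqP gnX /eqP clX].
move: clY; rewrite (wsumD1 _ _ fSge) => /eqP; rewrite addn_eq0 => /andP[/eqP fnY /eqP clY].
have fY : (otherend ends f x \in Y) = false.
  by move: fnY; rewrite (crossing_otherend _ jf) (negPf xY); case: (_ \in Y).
have gX : (otherend ends g x \in X) = false.
  by move: gnX; rewrite (crossing_otherend _ jg) (negPf xX); case: (_ \in X).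
have EQ : S :\ g :\ e :\ f = S :\ f :\ e :\ g.
  by rewrite setD1C [S :\ g :\ f]setD1C [S :\ f :\ g :\ e]setD1C.
(* Of all edges only [e] crosses [X :&: Y], but every cut is even. *)
have := even_crossing (X :&: Y) ev.
rewrite (wsumD1 _ _ fS) (wsumD1 _ _ eSf) (wsumD1 _ _ gSfe).
have [n12 [n13 [n10 [n23 [n20 [n30 [e1 e2 -> _]]]]]]] :=
  quadrants ends (S :\ f :\ e :\ g) X Y.
move: clX clY; rewrite EQ e1 e2 => c1 c2.
rewrite (crossing_otherend _ ie) (crossing_otherend _ jf) (crossing_otherend _ jg).
rewrite !inE (negPf xX) (negPf xY) eX eY fY gX !andbF /=.
have -> : n12 + n13 + n10 = 0 by clear -c1 c2; lia.
by [].
Qed.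

(** * The incidence graph of the vertices and the cycles *)

Definition inc_ends (V E : finType) (ends : E -> V * V)
  (a : E + V * {set E}) : (V + {set E}) * (V + {set E}) :=
  match a with
  | inl e => (inl (ends e).1, inl (ends e).2)
  | inr p => (inl p.1, inr p.2)
  end.

Definition inc_edges (V E : finType) (ends : E -> V * V) (O : {set {set E}}) :
  {set E + V * {set E}} :=
  [set a | match a with
           | inl e => e \notin cover O
           | inr p => (p.2 \in O) && (0 < deg ends p.2 p.1)
           end].

Lemma degE (V E : finType) (ends : E -> V * V) (S : {set E}) v :
  loopless ends -> deg ends S v = wsum ends S (endcount v).
Proof. by move=> ll; rewrite wsum_endcount. Qed.

Lemma deg_pos (V E : finType) (ends : E -> V * V) (S : {set E}) e v :
  e \in S -> incident ends e v -> 0 < deg ends S v.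
Proof. by move=> eS ie; apply/card_gt0P; exists e; rewrite inE eS. Qed.

Lemma crossing_le1 (V : finType) (X : {set V}) p : crossing X p <= 1.
Proof. exact: leq_b1. Qed.

Lemma wsum_eq0 (V E : finType) (ends : E -> V * V) (S : {set E}) w e :
  wsum ends S w = 0 -> e \in S -> w (ends e) = 0.
Proof. by move=> h eS; move/eqP: h; rewrite (wsumD1 _ _ eS) addn_eq0 => /andP[/eqP]. Qed.

Lemma wsum_gt0 (V E : finType) (ends : E -> V * V) (S : {set E}) w :
  0 < wsum ends S w -> exists2 e, e \in S & 0 < w (ends e).
Proof.
case: (pickP [pred e in S | 0 < w (ends e)]) => [e /andP[eS we] _|no]; first by exists e.
rewrite /wsum big1 // => e eS; have := no e; rewrite /= eS /= lt0n.
by move/negbT; rewrite negbK => /eqP.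
Qed.

Lemma card_cycle_vertices (V E : finType) (ends : E -> V * V) (C : {set E}) :
  loopless ends -> (forall v, deg ends C v = 0 \/ deg ends C v = 2) ->
  #|[set v | 0 < deg ends C v]| = #|C|.
Proof.
move=> ll d02; apply: double_inj.
have <- : \sum_(v in setT) wsum ends C (endcount v) = #|C|.*2.
  by rewrite sum_endcount -muln2 -sum_nat_const; apply: eq_bigr => e _; rewrite !inE.
rewrite -muln2 -sum_nat_const [RHS](bigID (mem [set v | 0 < deg ends C v])) /=.
rewrite [X in _ = _ + X]big1 ?addn0; last first.
  by move=> v; rewrite !inE /= -degE // lt0n negbK => /eqP.
rewrite big_mkcond [RHS]big_mkcond; apply: eq_bigr => v _; rewrite !inE /=.
by rewrite -/(wsum ends C (endcount v)) -degE //; case: (d02 v) => ->.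
Qed.

(** Makes every cycle of length at least 3 a vertex that the even subgraph must meet. *)
Lemma inc_degree (V E : finType) (ends : E -> V * V) (O : {set {set E}}) C :
  loopless ends -> C \in O -> is_cycle ends C ->
  #|C| <= wsum (inc_ends ends) (inc_edges ends O) (endcount (inr C)).
Proof.
move=> ll CO [_ [d02 _]]; rewrite wsum_endcount; last first.
  by case=> [e|p] _ //=; rewrite (inj_eq inl_inj) ll.
rewrite -(card_cycle_vertices ll d02).
rewrite -(@card_imset _ _ (fun v => inr (v, C) : E + V * {set E})); last by move=> u v [].
apply/subset_leq_card/subsetP => a /imsetP[v]; rewrite inE => dv ->.
by rewrite !inE /= CO dv /incident eqxx orbT.
Qed.

Lemma closed_connect_eq (V : finType) (r : rel V) (X : {set V}) x y :
  (forall a b, r a b -> (a \in X) = (b \in X)) -> connect r x y -> (x \in X) = (y \in X).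
Proof. by move=> h; apply: closed_connect. Qed.

Lemma adj_in_noncrossing (V E : finType) (ends : E -> V * V) (S : {set E}) (X : {set V}) a b :
  (forall e, e \in S -> incident ends e =1 pred2 a b -> crossing X (ends e) = 0) ->
  adj_in ends S a b -> (a \in X) = (b \in X).
Proof.
move=> h /existsP[e /andP[eS]].
have mem (c d : bool) : (c (+) d : nat) = 0 -> c = d by case: c; case: d.
case/orP=> /andP[/eqP e1 /eqP e2]; have := h e eS; rewrite /incident /crossing e1 e2.
  by move=> h'; apply: mem; apply: h' => v.
by move=> h'; apply/esym/mem; apply: h' => v /=; rewrite orbC.
Qed.

Lemma cycle_edge_noncrossing (V E : finType) (ends : E -> V * V) (O : {set {set E}})
    (X : {set V + {set E}}) C v (f : E) :
  C \in O -> f \in C ->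
  (forall b, b \in inc_edges ends O -> b != inr (v, C) -> crossing X (inc_ends ends b) = 0) ->
  ~~ incident ends f v ->
  crossing [set v | inl v \in X] (ends f) = 0.
Proof.
move=> CO fC h nif.
have key w : incident ends f w -> (inl w \in X) = (inr C \in X).
  move=> iw; have := h (inr (w, C)); rewrite inE /= CO (deg_pos fC iw) => /(_ isT).
  rewrite (inj_eq inr_inj) xpair_eqE eqxx andbT.
  have -> : w != v by apply: contraNneq nif => <-.
  by move=> /(_ isT); rewrite /crossing /=; do 2!case: (_ \in X).
by rewrite /crossing !inE !key ?addbb // /incident eqxx ?orbT.
Qed.

(** A bridge [inl e] would be a cut of size 1 in a graph with even degrees. A bridge [(v, C)] would
    make [v] a cut vertex of [G], unless all edges at [v] lie in [C]. *)
Lemma bridgeless_inc (V E : finType) (ends : E -> V * V) (O : {set {set E}}) t :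
  loopless ends -> 2 <= t -> three_connected ends -> regular ends [set: E] (2 * t) ->
  (forall C, C \in O -> is_cycle ends C) ->
  (forall C D, C \in O -> D \in O -> C != D -> [disjoint C & D]) ->
  bridgeless (inc_ends ends) (inc_edges ends O).
Proof.
move=> ll t2 [_ conn] reg cyc dis; apply/bridgelessP => X hX.
have [a aS ca] : exists2 a, a \in inc_edges ends O & 0 < crossing X (inc_ends ends a).
  by apply: wsum_gt0; rewrite hX.
have {}ca : crossing X (inc_ends ends a) = 1.
  by apply/eqP; rewrite eqn_leq ca crossing_le1.
have others b : b \in inc_edges ends O -> b != a -> crossing X (inc_ends ends b) = 0.
  move=> bS ba; apply: (@wsum_eq0 _ _ _ (inc_edges ends O :\ a)); last by rewrite !inE ba in bS *.
  by move: hX; rewrite (wsumD1 _ _ aS) ca => -[].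
move=> {hX}.
wlog vX : X ca others / forall v C, a = inr (v, C) -> inl v \in X.
  move=> W; have cX : crossing (~: X) =1 crossing X.
    by move=> p; rewrite /crossing !inE; do 2!case: (_ \in X).
  case: a aS ca others W => [e|[v C]] aS ca others W; first exact: (W X).
  case vX: (inl v \in X); first by apply: (W X) => // ? ? [<-].
  apply: (W (~: X)); rewrite ?cX //.
    by move=> b bS ba; rewrite cX others.
  by move=> ? ? [<- _]; rewrite inE vX.
pose X0 := [set v | inl v \in X].
have edge_out e : e \notin cover O -> inl e != a -> crossing X0 (ends e) = 0.
  by move=> eO ea; have := others (inl e); rewrite inE eO ea /crossing !inE; apply.
case: a aS ca others vX edge_out => [e|[v C]] aS ca others vX edge_out.
  have ev v : ~~ odd (wsum ends setT (endcount v)).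
    by rewrite -degE // reg oddM.
  have := even_crossing X0 ev; rewrite (wsumD1 _ _ (in_setT e)).
  have -> : crossing X0 (ends e) = 1 by rewrite -ca /crossing !inE.
  rewrite /wsum big1 // => f; rewrite !inE andbT => fe.
  case fO: (f \in cover O); last by apply: edge_out; rewrite ?fO // (inj_eq inl_inj).
  have /bigcupP[D DO fD] : f \in cover O by rewrite fO.
  have key w : incident ends f w -> (inl w \in X) = (inr D \in X).
    move=> iw; have := others (inr (w, D)); rewrite inE /= DO (deg_pos fD iw) => /(_ isT isT).
    by rewrite /crossing /=; do 2!case: (_ \in X).
  by rewrite /crossing !inE !key ?addbb // /incident eqxx ?orbT.
have {}vX : inl v \in X by apply: vX.
move: aS; rewrite inE /= => /andP[CO dv].
have CX : inr C \notin X.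
  by move: ca; rewrite /crossing /= vX; case: (_ \in X).
(* In [G] only edges of [C] at [v] can leave [X0]. *)
have cross f : crossing X0 (ends f) != 0 -> (f \in C) && incident ends f v.
  move=> cf; case fO: (f \in cover O); last first.
    by move: cf; rewrite edge_out ?fO.
  have /bigcupP[D DO fD] : f \in cover O by rewrite fO.
  case: (eqVneq D C) => [DC|DC].
    rewrite -{1}DC fD /=; apply: contraNT cf => nif.
    by apply/eqP/(cycle_edge_noncrossing CO _ others nif); rewrite -DC.
  case/negP: cf; have key w : incident ends f w -> (inl w \in X) = (inr D \in X).
    move=> iw; have := others (inr (w, D)); rewrite inE /= DO (deg_pos fD iw) => /(_ isT).
    rewrite (inj_eq inr_inj) xpair_eqE (negPf DC) andbF => /(_ isT).
    by rewrite /crossing /=; do 2!case: (_ \in X).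
  by rewrite /crossing !inE !key ?addbb // /incident eqxx ?orbT.
have /card_gt0P[f] := dv; rewrite inE => /andP[fC fv].
pose y := otherend ends f v.
have yv : y != v by apply: otherend_neq; apply: ll.
have yX : y \notin X0.
  have fy : incident ends f y by apply: incident_otherend.
  have := others (inr (y, C)); rewrite inE /= CO (deg_pos fC fy) => /(_ isT).
  rewrite (inj_eq inr_inj) xpair_eqE (negPf yv) => /(_ isT).
  by rewrite inE /crossing /= (negPf CX); case: (_ \in X).
(* After deleting [v] nothing leaves [X0], and [y] lies outside; connectivity leaves only [v] in
   [X0]. *)
have X0v x : x \in X0 -> x = v.
  move=> xX; apply/eqP; apply: contraT => xv.
  have clo p q : adj_avoid ends [set v] p q -> (p \in X0) = (q \in X0).
    move=> /andP[/andP[]]; rewrite !in_set1 => pv qv; apply: adj_in_noncrossing => g _ gpq.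
    apply/eqP; apply: contraT => /cross/andP[_]; rewrite gpq /= ![v == _]eq_sym.
    by rewrite (negPf pv) (negPf qv).
  have := closed_connect_eq clo (conn [set v] _ x y _ _).
  by rewrite cards1 !in_set1 xX (negPf yX) => /(_ isT xv yv).
(* Hence all [2 * t] edges at [v] belong to [C], which has only two there. *)
have : deg ends setT v <= deg ends C v.
  apply/subset_leq_card/subsetP => g; rewrite !inE => /= gv; rewrite gv andbT.
  suff /cross/andP[] : crossing X0 (ends g) != 0 by [].
  rewrite (crossing_otherend _ gv) inE vX.
  case: (boolP (_ \in X0)) => // /X0v /eqP.
  by rewrite (negPf (otherend_neq _ (ll g))).
rewrite reg; have [_ [/(_ v) d02 _]] := cyc _ CO.
by move: t2; case: d02 => ->; case: t reg => [|[|t']] // _ _; rewrite mul2n.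
Qed.

(** * Detaching a turn of each cycle *)

(** As the cycles are disjoint, at most one [C] qualifies for [pick]. *)
Definition split_end (V E : finType) (O : {set {set E}}) (vO : {set E} -> V)
  (e : E) (v : V) : V + {set E} :=
  if [pick C in O | (e \in C) && (vO C == v)] is Some C then inr C else inl v.

Definition split_ends (V E : finType) (ends : E -> V * V) (O : {set {set E}})
  (vO : {set E} -> V) (e : E) : (V + {set E}) * (V + {set E}) :=
  (split_end O vO e (ends e).1, split_end O vO e (ends e).2).

Definition unsplit_vertex (V E : finType) (vO : {set E} -> V) (x : V + {set E}) : V :=
  match x with inl v => v | inr C => vO C end.

Lemma split_endK (V E : finType) (O : {set {set E}}) (vO : {set E} -> V) e v :
  unsplit_vertex vO (split_end O vO e v) = v.
Proof. by rewrite /split_end; case: pickP => //= C /and3P[_ _ /eqP]. Qed.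

Lemma split_end_inl (V E : finType) (O : {set {set E}}) (vO : {set E} -> V) e v :
  (forall C, C \in O -> e \in C -> vO C != v) -> split_end O vO e v = inl v.
Proof.
move=> h; rewrite /split_end; case: pickP => // C /and3P[CO eC].
by rewrite (negPf (h _ CO eC)).
Qed.

Lemma split_end_inr (V E : finType) (O : {set {set E}}) (vO : {set E} -> V) e v C :
  (forall C D, C \in O -> D \in O -> C != D -> [disjoint C & D]) ->
  (split_end O vO e v == inr C) = [&& C \in O, e \in C & vO C == v].
Proof.
move=> dis; rewrite /split_end; case: pickP => [D /and3P[DO eD vD]|none].
  rewrite (inj_eq inr_inj); apply/eqP/and3P => [<- //|[CO eC _]].
  apply/eqP; apply: contraT => DC.
  by have /pred0P/(_ e) := dis _ _ DO CO DC; rewrite /= eD eC.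
by rewrite -[RHS]/([&& C \in O, e \in C & vO C == v]) none.
Qed.

Lemma endcount_split_inr (V E : finType) (ends : E -> V * V) (O : {set {set E}})
    (vO : {set E} -> V) e C :
  (forall C D, C \in O -> D \in O -> C != D -> [disjoint C & D]) ->
  endcount (inr C) (split_ends ends O vO e) =
  ((C \in O) && (e \in C)) * endcount (vO C) (ends e).
Proof.
move=> dis; rewrite /endcount /= !split_end_inr // ![vO C == _]eq_sym.
by case: (C \in O); case: (e \in C); rewrite ?mul1n.
Qed.

Lemma wsum_split_inr (V E : finType) (ends : E -> V * V) (O : {set {set E}})
    (vO : {set E} -> V) C :
  (forall C D, C \in O -> D \in O -> C != D -> [disjoint C & D]) ->
  wsum (split_ends ends O vO) setT (endcount (inr C)) =
  (C \in O) * wsum ends C (endcount (vO C)).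
Proof.
move=> dis; rewrite /wsum big_distrr [RHS]big_mkcond [LHS]big_mkcond; apply: eq_bigr => e _ /=.
by rewrite in_setT endcount_split_inr //; case: (C \in O); case: (e \in C); rewrite ?mul1n.
Qed.

Lemma wsum_unsplit (V E : finType) (ends : E -> V * V) (O : {set {set E}})
    (vO : {set E} -> V) (F : {set E}) v :
  wsum ends F (endcount v) =
  \sum_(x | unsplit_vertex vO x == v) wsum (split_ends ends O vO) F (endcount x).
Proof.
have := sum_endcount (split_ends ends O vO) F [set x | unsplit_vertex vO x == v].
rewrite (eq_bigl (fun x => unsplit_vertex vO x == v)); last by move=> x; rewrite inE.
by move->; apply: eq_bigr => e _; rewrite !inE /= !split_endK.
Qed.

(* [u] cuts the cycle [C] open into a path, so a set not crossed by the edges of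
   [C] away from [u] contains all or none of the other vertices: otherwise its
   two parts would each send at least two edges to [u]. *)
Lemma cycle_minus_vertex (V E : finType) (ends : E -> V * V) (C : {set E}) (X : {set V}) u p q :
  loopless ends -> is_cycle ends C -> 0 < deg ends C u ->
  (forall f, f \in C -> ~~ incident ends f u -> crossing X (ends f) = 0) ->
  p != u -> q != u -> 0 < deg ends C p -> 0 < deg ends C q ->
  p \in X -> q \in X.
Proof.
move=> ll [_ [d02 conn]] du h pu qu dp dq pX; apply: contraT => qX.
pose VC := [set v | (v != u) && (0 < deg ends C v)].
pose Y1 := VC :&: X; pose Y2 := VC :\: X.
have ev v : ~~ odd (wsum ends C (endcount v)).
  by rewrite -degE //; case: (d02 v) => ->.
(* An edge of [C] leaving [Y1] or [Y2] ends at [u], and leaves only one of them. *)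
have key f : f \in C -> crossing Y1 (ends f) + crossing Y2 (ends f) <= endcount u (ends f).
  move=> fC; rewrite endcount_nonloop ?ll //.
  case iu: (incident ends f u).
    rewrite !(crossing_otherend _ iu) !inE eqxx /=.
    by case: (_ \in X); rewrite ?andbF ?andbT; case: (_ && _).
  have := h _ fC (negbT iu); move: iu; rewrite /incident => /norP[/negPf u1 /negPf u2].
  have d1 : 0 < deg ends C (ends f).1 by apply: (deg_pos fC); rewrite /incident eqxx.
  have d2 : 0 < deg ends C (ends f).2 by apply: (deg_pos fC); rewrite /incident eqxx orbT.
  by rewrite /crossing !inE d1 d2 ![_ == u]eq_sym u1 u2 /=; do 2!case: (_ \in X).
(* The cut is even, and not empty because [C] is connected and [u] lies on it outside [Y]. *)
have big (Y : {set V}) z : z \in Y -> Y \subset VC -> 1 < wsum ends C (crossing Y).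
  move=> zY YV; have := even_crossing Y ev.
  case E0: (wsum ends C (crossing Y)) => [|[|k]] // _.
  have dz : 0 < deg ends C z by move: (subsetP YV _ zY); rewrite inE => /andP[].
  have clo a b : adj_in ends C a b -> (a \in Y) = (b \in Y).
    by apply: adj_in_noncrossing => e eC _; apply: wsum_eq0 E0 eC.
  have := closed_connect_eq clo (conn _ _ dz du); rewrite zY => /esym/(subsetP YV).
  by rewrite inE eqxx.
have b1 : 1 < wsum ends C (crossing Y1).
  by apply: (big _ p); rewrite ?subsetIl // !inE pu dp pX.
have b2 : 1 < wsum ends C (crossing Y2).
  by apply: (big _ q); rewrite ?subsetDl // !inE qu dq qX.
have : wsum ends C (crossing Y1) + wsum ends C (crossing Y2) <= wsum ends C (endcount u).
  by rewrite /wsum -big_split; apply: leq_sum => f /key.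
rewrite -degE //; case: (d02 u) => ->; clear -b1 b2; lia.
Qed.

(** Detaching leaves [C] connected through [inr C]: the path of [C] away from [vO C] is kept, and
    [inr C] is joined to a neighbour [q] on it. *)
Lemma split_noncrossing (V E : finType) (ends : E -> V * V) (O : {set {set E}})
    (vO : {set E} -> V) (X : {set V + {set E}}) C p :
  loopless ends -> (forall C, C \in O -> is_cycle ends C) ->
  (forall C D, C \in O -> D \in O -> C != D -> [disjoint C & D]) ->
  wsum (split_ends ends O vO) setT (crossing X) = 0 ->
  C \in O -> 0 < deg ends C (vO C) -> 0 < deg ends C p -> p != vO C ->
  (inl p \in X) = (inr C \in X).
Proof.
move=> ll cyc dis clX CO du dp pu; set u := vO C.
have uniqC f D : f \in C -> D \in O -> f \in D -> D = C.
  move=> fC DO fD; apply/eqP; apply: contraT => DC.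
  by have /pred0P/(_ f) := dis _ _ DO CO DC; rewrite /= fC fD.
have seu f : f \in C -> split_end O vO f u = inr C.
  by move=> fC; apply/eqP; rewrite split_end_inr // CO fC /=.
have sev f v : f \in C -> v != u -> split_end O vO f v = inl v.
  move=> fC vu; apply: split_end_inl => D DO fD.
  by rewrite (uniqC _ _ fC DO fD) eq_sym.
have noX f : ((split_ends ends O vO f).1 \in X) = ((split_ends ends O vO f).2 \in X).
  have := wsum_eq0 clX (in_setT f); rewrite /crossing.
  by do 2!case: (_ \in X).
pose X0 := [set v | inl v \in X].
have h f : f \in C -> ~~ incident ends f u -> crossing X0 (ends f) = 0.
  rewrite /incident => fC /norP[u1 u2]; have := noX f.
  by rewrite /split_ends /= !sev 1?eq_sym // /crossing !inE => ->; rewrite addbb.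
have /card_gt0P[f] := du; rewrite inE => /andP[fC fu].
pose q := otherend ends f u.
have qu : q != u by apply/otherend_neq/ll.
have dq : 0 < deg ends C q by apply: (deg_pos fC); apply: incident_otherend.
have -> : (inr C \in X) = (inl q \in X).
  have := noX f; rewrite /split_ends /= /q /otherend.
  move: fu qu; rewrite /incident /q /otherend eq_sym; case: eqP => [->|_] /=.
    by move=> _ e2; rewrite seu // sev.
  by move=> /eqP <- e1; rewrite seu // sev.
have cm := cycle_minus_vertex ll (cyc _ CO) du h.
by apply/idP/idP => iX; [have := cm p q|have := cm q p]; rewrite !inE; apply.
Qed.

(* Counting the edges inside a closed set [X] by degrees, their number has the
   parity of the number of [C] whose incidence [(vO C, C)] crosses [X]; these are
   all the edges of the even subgraph [Z] that cross [X]. *)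
Lemma closed_even_split (V E : finType) (ends : E -> V * V) (O : {set {set E}}) t
    (vO : {set E} -> V) (Z : {set E + V * {set E}}) :
  loopless ends -> ~~ odd t -> regular ends [set: E] (2 * t) ->
  (forall C, C \in O -> is_cycle ends C) ->
  (forall C D, C \in O -> D \in O -> C != D -> [disjoint C & D]) ->
  Z \subset inc_edges ends O ->
  (forall x, ~~ odd (wsum (inc_ends ends) Z (endcount x))) ->
  (forall C, C \in O -> inr (vO C, C) \in Z) ->
  closed_even (split_ends ends O vO) xpredT setT.
Proof.
move=> ll t2 reg cyc dis ZS evZ vOZ; apply/forallP => X; apply/implyP => /eqP clX.
have dvO C : C \in O -> 0 < deg ends C (vO C).
  by move=> /vOZ /(subsetP ZS); rewrite inE /= => /andP[].
have d2 C : C \in O -> wsum ends C (endcount (vO C)) = 2.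
  move=> CO; rewrite -degE //; have [_ [/(_ (vO C)) d02 _]] := cyc _ CO.
  by have := dvO _ CO; case: d02 => ->.
have noX f : ((split_ends ends O vO f).1 \in X) = ((split_ends ends O vO f).2 \in X).
  have := wsum_eq0 clX (in_setT f); rewrite /crossing.
  by do 2!case: (_ \in X).
pose N1 := \sum_(C in O) ((inl (vO C) \in X) : nat).
pose N2 := \sum_(C in O) ((inr C \in X) : nat).
have par : odd N1 = odd N2.
  have cr : wsum (inc_ends ends) Z (crossing X) =
      \sum_(C in O) ((inl (vO C) \in X) (+) (inr C \in X) : nat).
    pose Zs := [set (inr (vO C, C) : E + V * {set E}) | C in O].
    have ZsZ : Zs \subset Z by apply/subsetP => a /imsetP[C /vOZ CZ ->].
    (* The other edges of [Z] do not cross: edges on no cycle survive the detaching, and other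
       incidences join vertices on the same side. *)
    rewrite /wsum (big_setID Zs) /= [X in _ + X]big1 ?addn0; last first.
      case=> [e|[p C]]; rewrite !inE => /andP[nZs aZ].
        have := subsetP ZS _ aZ; rewrite inE /= => eO.
        have eN C : C \in O -> e \in C -> False.
          by move=> CO eC; case/negP: eO; apply/bigcupP; exists C.
        have := noX e; rewrite /split_ends /= !split_end_inl //; first last.
        + by move=> C CO /(eN _ CO).
        + by move=> C CO /(eN _ CO).
        by rewrite /crossing /= => ->; rewrite addbb.
      have := subsetP ZS _ aZ; rewrite inE /= => /andP[CO dp].
      have pu : p != vO C.
        by apply: contraNneq nZs => ->; apply/imsetP; exists C.
      by rewrite /crossing /= (split_noncrossing ll cyc dis clX CO (dvO _ CO) dp pu) addbb.
    rewrite (setIidPr ZsZ) big_imset /=; last by move=> C D _ _ [].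
    by apply: eq_bigr.
  have := even_crossing X evZ; rewrite cr.
  have : \sum_(C in O) ((inl (vO C) \in X) (+) (inr C \in X) : nat) +
         (\sum_(C in O) ((inl (vO C) \in X) && (inr C \in X) : nat)).*2 = N1 + N2.
    rewrite -mul2n big_distrr -!big_split /=; apply: eq_bigr => C _.
    by do 2!case: (_ \in X).
  move/(congr1 odd); rewrite !oddD odd_double addbF => ->.
  by case: (odd N1); case: (odd N2).
pose A := \sum_(v | inl v \in X) wsum (split_ends ends O vO) setT (endcount (inl v)).
(* The degree sum over [X] in the detached graph, in which each [inr C] with [C] in [O] has degree
   2. *)
have eqM : A + N2.*2 = (odd_inside (split_ends ends O vO) xpredT setT X).*2.
  have := sum_endcount (split_ends ends O vO) setT X.
  rewrite big_sumType /= -/A => e1; move: (e1).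
  rewrite [X in _ + X](_ : _ = N2.*2).
    move->; rewrite /odd_inside -mul2n big_distrr; apply: eq_bigr => e _ /=.
    by rewrite -noX mul2n addnn.
  rewrite -mul2n big_distrr big_mkcond [RHS]big_mkcond; apply: eq_bigr => C _ /=.
  rewrite wsum_split_inr //; case CO: (C \in O); last by case: ifP.
  by rewrite d2 //; case: (_ \in X).
(* Reattaching the turns restores degree [2 * t] at every vertex of [G]. *)
have eqT : A + N1.*2 = #|[set v | inl v \in X]| * (2 * t).
  rewrite -sum_nat_const.
  transitivity (\sum_(v | inl v \in X) (wsum (split_ends ends O vO) setT (endcount (inl v)) +
     \sum_(C | (inl (vO C) \in X) && (vO C == v)) (C \in O).*2)).
    rewrite big_split -/A; congr (_ + _).
    rewrite -(partition_big vO (fun v => inl v \in X)) //=.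
    rewrite -mul2n big_distrr big_mkcond [RHS]big_mkcond; apply: eq_bigr => C _ /=.
    by case: (C \in O); case: (_ \in X).
  rewrite [RHS]big_mkcond [LHS]big_mkcond; apply: eq_bigr => v _; rewrite inE.
  case: ifP => // vX; rewrite -(reg v) degE // (wsum_unsplit ends O vO) big_sumType /=.
  rewrite big_pred1_eq; congr (_ + _); apply: eq_big => [C|C _].
    by case: eqP => [->|]; rewrite ?vX ?andbF.
  rewrite wsum_split_inr //; case CO: (C \in O) => //=; by rewrite d2.
have : odd_inside (split_ends ends O vO) xpredT setT X + N1 =
       #|[set v | inl v \in X]| * t + N2.
  by move: eqM eqT; clear; nia.
move/(congr1 odd); rewrite !oddD oddM (negPf t2) andbF par.
by case: (odd _); case: (odd N2).
Qed.

(** * The factor as a colour class *)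

Theorem theorem6p5 (V E : finType) (ends : E -> V * V) (t : nat)
  (O : {set {set E}}) :
  loopless ends ->
  2 <= t -> ~~ odd t ->
  three_connected ends ->
  regular ends [set: E] (2 * t) ->
  (forall C, C \in O -> is_cycle ends C /\ 3 <= #|C|) ->
  (forall C D, C \in O -> D \in O -> C != D -> [disjoint C & D]) ->
  exists F : {set E}, t_factor ends t F /\
    forall C, C \in O -> (C :&: F != set0) /\ (C :&: (setT :\: F) != set0).
Proof.
move=> ll t2 tev con reg cyc3 dis.
have cyc C : C \in O -> is_cycle ends C by move=> /cyc3[].
have bl := bridgeless_inc ll t2 con reg cyc dis.
have /card_gt0P[v0 _] : 0 < #|V| by case: con => + _; apply: leq_trans.
have /card_gt0P[e0 _] : 0 < deg ends setT v0 by rewrite reg muln_gt0 (leq_trans _ t2).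
(* The prescribed label is arbitrary here. *)
have [Z [ZS evZ covZ _]] := covering_even_subgraph (inl e0) bl.
(* The default [v0] is never taken for [C] in [O], since [Z] meets the vertex [inr C]. *)
pose vO C := odflt v0 [pick v | inr (v, C) \in Z].
have vOZ C : C \in O -> inr (vO C, C) \in Z.
  move=> CO; rewrite /vO; case: pickP => //= none.
  have := covZ (inr C) (leq_trans (cyc3 _ CO).2 (inc_degree ll CO (cyc _ CO))).
  move/wsum_gt0 => [[e|[v D]] aZ] //; rewrite /endcount /= (inj_eq inr_inj) /=.
  by case: eqP => // DC; have := none v; rewrite /= -DC aZ.
have dvO C : C \in O -> wsum ends C (endcount (vO C)) = 2.
  move=> CO; have := subsetP ZS _ (vOZ _ CO); rewrite inE /= -degE // => /andP[_].
  by have [_ [/(_ (vO C)) []-> _]] := cyc _ CO.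
pose sp := split_ends ends O vO.
have evC C : ~~ odd (wsum sp setT (endcount (inr C))).
  by rewrite wsum_split_inr //; case CO: (C \in O) => //; rewrite dvO.
have evS x : ~~ odd (wsum sp setT (endcount x)).
  case: x => [v|C] //.
  have : ~~ odd (wsum ends setT (endcount v)) by rewrite -degE // reg oddM.
  rewrite (wsum_unsplit ends O vO) big_sumType /= big_pred1_eq oddD.
  by rewrite (negPf (odd_sum_even (fun C _ => evC C))) addbF.
have [k bal] := exists_balanced evS (closed_even_split ll tev reg cyc dis ZS evZ vOZ).
(* All signs are odd, so each edge has one colour at both ends and a colour class has half of every
   degree. *)
pose F := [set e | k e].
have half x : (wsum sp F (endcount x)).*2 = wsum sp setT (endcount x).
  rewrite -bal; congr _.*2; rewrite /wsum big_mkcond [RHS]big_mkcond.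
  apply: eq_bigr => e _; rewrite !inE /true_ends /endcount addbF.
  by case: (k e); rewrite ?andbT ?andbF.
exists F; split.
  move=> v; apply: double_inj; rewrite degE // (wsum_unsplit ends O vO) -mul2n big_distrr /=.
  rewrite (eq_bigr (fun x => wsum sp setT (endcount x))); last by move=> x _; rewrite mul2n half.
  by rewrite -wsum_unsplit -degE // reg mul2n.
move=> C CO.
(* So exactly one of the two edges of [C] at [inr C] lies in [F]. *)
have hC : (wsum sp F (endcount (inr C))).*2 = 2 by rewrite half wsum_split_inr // CO dvO.
have out e : e \notin C -> endcount (inr C) (sp e) = 0.
  by move=> /negPf eC; rewrite endcount_split_inr // eC andbF.
split; apply/set0Pn.
  have /wsum_gt0[e eF] : 0 < wsum sp F (endcount (inr C)) by move: hC; case: wsum.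
  case eC: (e \in C); last by rewrite out ?eC.
  by exists e; rewrite inE eC.
case: (pickP (mem (C :&: (setT :\: F)))) => [e|none]; first by exists e.
(* If [C] lay inside [F], the degree of [inr C] in [F] would be 2 instead of 1. *)
have : wsum sp setT (endcount (inr C)) <= wsum sp F (endcount (inr C)).
  rewrite /wsum big_mkcond [leqRHS]big_mkcond; apply: leq_sum => e _; rewrite in_setT.
  case: ifP => // eF; case eC: (e \in C); last by rewrite out ?eC.
  by have := none e; rewrite /= !inE eC; move: eF; rewrite inE => ->.
by rewrite -half hC; case: wsum hC => [|[|]].
Qed.
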